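(* Every Bonnet-Myers sharp graph of diameter $3$ is self-centered. Consequently, the Bonnet-Myers sharp graphs of diameter $3$ are (up to isomorphism) precisely the following four graphs: (1) the cube $Q^3$; (2) the Johnson graph $J(6,3)$; (3) the demi-cube $Q^6_{(2)}$; (4) the Gosset graph.
   Context: All graphs $G=(V,E)$ are finite, simple and connected; $d$ is the combinatorial (shortest path) distance, $B_1(x)=\{v: d(x,v)\le 1\}$, and $\operatorname{diam}(G)=\max_{x,y}d(x,y)$. A vertex $x$ is a pole if there is a vertex $y$ with $d(x,y)=\operatorname{diam}(G)$; $G$ is self-centered if every vertex is a pole. Let $G$ be $D$-regular (all vertices have degree $D$). For probability measures $\mu_1,\mu_2$ on $V$, $W_1(\mu_1,\mu_2)=\inf_\pi\sum_{x,y\in V}d(x,y)\pi(x,y)$, the infimum over all $\pi:V\times V\to[0,1]$ with marginals $\mu_1$ and $\mu_2$. Let $\mu_x$ be the uniform probability measure on $B_1(x)$ (mass $\frac1{D+1}$ at each vertex of $B_1(x)$). The Ollivier Ricci curvature of an edge $\{x,y\}$ is $\kappa(x,y)=\frac{D+1}{D}(1-W_1(\mu_x,\mu_y))$. A regular graph $G$ with $K=\inf_{\{x,y\}\in E}\kappa(x,y)>0$ always satisfies $\operatorname{diam}(G)\le 2/K$; it is called Bonnet-Myers sharp if $\operatorname{diam}(G)=2/K$, equivalently $\inf_{\{x,y\}\in E}\kappa(x,y)=2/\operatorname{diam}(G)$. Named graphs: $Q^3$ has vertex set $\{0,1\}^3$, two vertices adjacent iff they differ in exactly one coordinate. $J(6,3)$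 has as vertices the $3$-element subsets of a $6$-element set, two adjacent iff their intersection has exactly $2$ elements. $Q^6_{(2)}$ has as vertices the elements of $\{0,1\}^6$ with an even number of ones, two adjacent iff they differ in exactly two coordinates. The Gosset graph has as its $56$ vertices the vectors of $\mathbb{R}^8$ obtained from $\pm(3,3,-1,-1,-1,-1,-1,-1)$ by permuting coordinates, two adjacent iff their inner product is $8$. *)

(* Defs.v *)
From mathcomp Require Import all_boot all_order all_algebra all_fingroup.
From mathcomp Require Import boolp classical_sets reals.
From mathcomp Require Import ring.
Set Implicit Arguments.
Unset Strict Implicit.
Unset Printing Implicit Defensive.
Import Order.TTheory GRing.Theory Num.Theory.
Local Open Scope ring_scope.

Record sgraph := SGraph {
  vertex :> finType;
  adj : rel vertex;
  adj_sym : symmetric adj;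
  adj_irr : irreflexive adj }.

Definition connected_graph (G : sgraph) : Prop :=
  forall x y : G, connect (@adj G) x y.

Definition walk (G : sgraph) (x y : G) (n : nat) : bool :=
  [exists p : n.-tuple G, path (@adj G) x p && (last x p == y)].

(* A shortest path has fewer than #|G| edges, so when x and y are connected   *)
(* the index found is the length of a shortest path; otherwise it is #|G|.    *)
Definition dist (G : sgraph) (x y : G) : nat :=
  find (walk x y) (iota 0 #|G|).

Definition diam (G : sgraph) : nat :=
  (\max_(x : G) \max_(y : G) dist x y)%N.

Definition pole (G : sgraph) (x : G) : Prop :=
  exists y : G, dist x y = diam G.

Definition self_centered (G : sgraph) : Prop := forall x : G, pole x.

Definition regular (G : sgraph) (D : nat) : Prop :=
  forall x : G, #|[pred y | adj x y]| = D.

Section Curvature.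
Variables (R : realType) (G : sgraph).

(* Measures on the finite vertex set are given by their mass functions. *)
Definition coupling (mu1 mu2 : G -> R) (pi : G -> G -> R) : Prop :=
  [/\ forall x y, 0 <= pi x y <= 1,
      forall x, \sum_(y : G) pi x y = mu1 x &
      forall y, \sum_(x : G) pi x y = mu2 y].

Definition W1 (mu1 mu2 : G -> R) : R :=
  inf [set \sum_(x : G) \sum_(y : G) (dist x y)%:R * pi x y
      | pi in [set pi | coupling mu1 mu2 pi]]%classic.

Definition ball_measure (D : nat) (x : G) : G -> R :=
  fun z => if (dist x z <= 1)%N then D.+1%:R^-1 else 0.

Definition curvature (D : nat) (x y : G) : R :=
  D.+1%:R / D%:R * (1 - W1 (ball_measure D x) (ball_measure D y)).

(* An edgeless graph gets the value inf set0 = 0. *)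
Definition inf_curvature (D : nat) : R :=
  inf [set k | exists x y : G, adj x y /\ k = curvature D x y]%classic.

Definition bonnet_myers_sharp : Prop :=
  exists D : nat, [/\ regular G D, 0 < inf_curvature D
                    & (diam G)%:R = 2 / inf_curvature D].

End Curvature.

Definition isomorphic (G H : sgraph) : Prop :=
  exists f : G -> H, bijective f /\ forall x y : G, adj (f x) (f y) = adj x y.

Definition hamming n (x y : {ffun 'I_n -> bool}) : nat :=
  #|[pred i | x i != y i]|.

Lemma hammingC n (x y : {ffun 'I_n -> bool}) : hamming x y = hamming y x.
Proof. by apply: eq_card => i; rewrite !inE eq_sym. Qed.

Lemma hammingxx n (x : {ffun 'I_n -> bool}) : hamming x x = 0%N.
Proof. by apply: eq_card0 => i; rewrite !inE eqxx. Qed.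

Definition cube3_adj : rel {ffun 'I_3 -> bool} :=
  [rel x y | hamming x y == 1%N].

Lemma cube3_sym : symmetric cube3_adj.
Proof. by move=> x y; rewrite /cube3_adj /= hammingC. Qed.

Lemma cube3_irr : irreflexive cube3_adj.
Proof. by move=> x; rewrite /cube3_adj /= hammingxx. Qed.

Definition cube3 : sgraph := SGraph cube3_sym cube3_irr.

Definition johnson63_vertex := {A : {set 'I_6} | #|A| == 3%N}.

Definition johnson63_adj : rel johnson63_vertex :=
  [rel A B | #|(val A :&: val B)%SET| == 2%N].

Lemma johnson63_sym : symmetric johnson63_adj.
Proof. by move=> A B; rewrite /johnson63_adj /= finset.setIC. Qed.

Lemma johnson63_irr : irreflexive johnson63_adj.
Proof. by move=> A; rewrite /johnson63_adj /= finset.setIid (eqP (valP A)). Qed.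

Definition johnson63 : sgraph := SGraph johnson63_sym johnson63_irr.

Definition demicube6_vertex :=
  {x : {ffun 'I_6 -> bool} | ~~ odd #|[pred i | x i]|}.

Definition demicube6_adj : rel demicube6_vertex :=
  [rel x y | hamming (val x) (val y) == 2%N].

Lemma demicube6_sym : symmetric demicube6_adj.
Proof. by move=> x y; rewrite /demicube6_adj /= hammingC. Qed.

Lemma demicube6_irr : irreflexive demicube6_adj.
Proof. by move=> x; rewrite /demicube6_adj /= hammingxx. Qed.

Definition demicube6 : sgraph := SGraph demicube6_sym demicube6_irr.

Section Gosset.
Variable R : realType.

Definition gosset_base : 'rV[R]_8 := \row_(i < 8) (if (i < 2)%N then 3 else -1).

Definition gosset_vectors : seq 'rV[R]_8 :=
  [seq col_perm s v | v <- [:: gosset_base; - gosset_base],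
                      s <- enum {: {perm 'I_8}}].

Definition inner (u v : 'rV[R]_8) : R := \sum_(i < 8) u 0 i * v 0 i.

Definition gosset_adj : rel (seq_sub gosset_vectors) :=
  [rel u v | inner (val u) (val v) == 8].

Lemma gosset_sym : symmetric gosset_adj.
Proof.
by move=> u v; rewrite /gosset_adj /= /inner; under eq_bigr do rewrite mulrC.
Qed.

Lemma inner_gosset_base s :
  inner (col_perm s gosset_base) (col_perm s gosset_base) = 24.
Proof.
rewrite /inner; under eq_bigr do rewrite mxE.
rewrite -(reindex_inj (h := s) (P := xpredT)
  (F := fun i => gosset_base 0 i * gosset_base 0 i)) /=; last exact: perm_inj.
rewrite !big_ord_recl big_ord0 !mxE /=; ring.
Qed.

Lemma gosset_irr : irreflexive gosset_adj.
Proof.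
move=> [u uG]; rewrite /gosset_adj /=.
have -> : inner u u = 24.
  case/allpairsP: uG => -[v s] /= [+ _ ->].
  rewrite !inE => /orP[] /eqP ->; first exact: inner_gosset_base.
  rewrite -(inner_gosset_base s) /inner; apply: eq_bigr => i _.
  by rewrite !mxE mulrNN.
by rewrite eqr_nat.
Qed.

Definition gosset : sgraph := SGraph gosset_sym gosset_irr.

End Gosset.

(* Main.v *)
Require Import Defs.
From HB Require Import structures.
From mathcomp Require Import all_boot all_order all_algebra all_fingroup.
From mathcomp Require Import boolp classical_sets reals.
From mathcomp Require Import ring lra zify.
From mathcomp Require Import fintype finset.
Set Implicit Arguments.
Unset Strict Implicit.
Unset Printing Implicit Defensive.
Import Order.TTheory GRing.Theory Num.Theory.
Local Open Scope ring_scope.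

(* Let D be the degree and let x, y be at distance 3.  Testing the transport
   costs along edges against the 1-Lipschitz functions d(x,.) and d(y,.) and
   summing over the graph gives d(x,.) + d(y,.) = 3 together with equality in all
   the estimates; hence D = 3k, the graph is {x, y} together with the
   neighbourhoods A of x and B of y, and every vertex of A (of B) has k + 1
   neighbours in B (in A).  Call two vertices of A collinear if they are distinct
   and not adjacent; each is collinear to k + 1 others.  Further test functions
   show that collinear a, a' have a common neighbour b in B, and that a is
   collinear to at most one neighbour of b.  Counting the neighbours of b in A
   shows that a, a' have a common collinear point, and a double count shows that
   it is unique.  So A is a generalized quadrangle with three points on each line,
   and each vertex of B is joined to precisely the points collinear to some p in
   A, to which it is then antipodal.  The graph is thus the antipodal double of
   the quadrangle, in particular self-centered.  The quadrangles GQ(2,t) are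
   classified by hand: k is 1, 3, 5 or 9, and the quadrangle is determined by k.
   Conversely, in each of the four doubles an explicit matching realises the
   optimal transport along every edge. *)

(** * Distance *)

Section Distance.
Variable G : sgraph.
Implicit Types x y z : G.

Lemma walkP x y n :
  reflect (exists p, [/\ path (@adj G) x p, last x p = y & size p = n])
          (walk x y n).
Proof.
apply: (iffP existsP) => [[p /andP[pp /eqP lp]]|[p [pp lp sp]]].
  by exists p; rewrite size_tuple.
by have Hs : size p == n by [apply/eqP]; exists (Tuple Hs); rewrite /= pp lp eqxx.
Qed.

Lemma dist_le x p : path (@adj G) x p -> (dist x (last x p) <= size p)%N.
Proof.
move=> pp; rewrite /dist.
have [sp|sp] := ltnP (size p) #|G|; last first.
  by apply: leq_trans sp; rewrite -[X in (_ <= X)%N](size_iota 0) find_size.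
rewrite leqNgt; apply/negP => /(before_find 0).
rewrite nth_iota // add0n => /walkP; apply; by exists p.
Qed.

Lemma dist_xx x : dist x x = 0.
Proof. by apply/eqP; rewrite -leqn0; apply: (@dist_le x [::]). Qed.

Hypothesis Gc : connected_graph G.

Lemma dist_path x y :
  exists p, [/\ path (@adj G) x p, last x p = y & size p = dist x y].
Proof.
case/connectP: (Gc x y) => p0 pp0 ->; case: (shortenP pp0) => p pp up _.
have sp : (size p < #|G|)%N by have /card_uniqP h := up;
  rewrite -[(size p).+1]/(size (x :: p)) -h max_card.
apply/walkP; rewrite /dist.
have hs : has (walk x (last x p)) (iota 0 #|G|).
  apply/hasP; exists (size p); first by rewrite mem_iota.
  by apply/walkP; exists p.
have := nth_find 0 hs; rewrite nth_iota ?add0n //.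
by move: hs; rewrite has_find size_iota.
Qed.

Lemma dist_eq0 x y : (dist x y == 0%N) = (x == y).
Proof.
apply/eqP/eqP => [|->]; last exact: dist_xx.
by have [p [_ + <-]] := dist_path x y; case: p.
Qed.

(** Applied to distance functions, this gives the symmetry of [dist] and the triangle inequality;
    later it bounds transport costs from below. *)
Lemma lip_dist (f : G -> int) x y :
  (forall u v, adj u v -> f v <= f u + 1) -> f y <= f x + (dist x y)%:Z.
Proof.
move=> fl; have [p [pp <- <-]] := dist_path x y.
elim: p x pp => [|z p IH] x /=; first by rewrite addr0.
by case/andP=> xz /IH h; have := fl _ _ xz; lia.
Qed.

Lemma dist_adjl u v y : adj u v -> (dist u y <= (dist v y).+1)%N.
Proof.
move=> uv; have [p [pp <- <-]] := dist_path v y.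
by apply: (@dist_le u (v :: p)); rewrite /= uv.
Qed.

Lemma dist_sym x y : dist x y = dist y x.
Proof.
suff h (u v : G) : (dist v u <= dist u v)%N by apply/eqP; rewrite eqn_leq !h.
have := @lip_dist (fun z => (dist z u)%:Z) u v.
rewrite /= dist_xx add0r => h; rewrite -lez_nat; apply: h => s t.
by rewrite adj_sym => /(@dist_adjl _ _ u); lia.
Qed.

Lemma dist_adjr x u v : adj u v -> (dist x v <= (dist x u).+1)%N.
Proof. by move=> uv; rewrite 2!(dist_sym x); apply: dist_adjl; rewrite adj_sym. Qed.

Lemma dist_triangle x y z : (dist x z <= dist x y + dist y z)%N.
Proof.
have := @lip_dist (fun z => (dist x z)%:Z) y z.
rewrite -PoszD lez_nat; apply => s t /(dist_adjr x); lia.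
Qed.

Lemma dist_eq1 x y : (dist x y == 1%N) = adj x y.
Proof.
apply/eqP/idP => [|xy].
  have [p [+ <- <-]] := dist_path x y; case: p => // z [] //=.
  by rewrite andbT.
apply/eqP; rewrite eqn_leq (@dist_le x [:: y]) /= ?xy // lt0n dist_eq0.
by apply: contraTneq xy => ->; rewrite adj_irr.
Qed.

Lemma dist_le1 x y : (dist x y <= 1)%N = (y == x) || adj x y.
Proof. by rewrite leq_eqVlt ltnS leqn0 dist_eq1 dist_eq0 orbC eq_sym. Qed.

Lemma dist_le_diam x y : (dist x y <= diam G)%N.
Proof.
apply: (leq_trans _ (leq_bigmax x)).
by apply: (leq_trans _ (leq_bigmax y)).
Qed.

Lemma diam_attained : (0 < #|G|)%N -> exists x y : G, dist x y = diam G.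
Proof.
move=> G0.
have [x hx] := @bigop.eq_bigmax (vertex G) (fun x : G => \max_(y : G) dist x y)%N G0.
have [y hy] := @bigop.eq_bigmax (vertex G) (fun y : G => dist x y) G0.
by exists x, y; rewrite /diam hx hy.
Qed.

End Distance.

(** * Transport costs *)

Definition B1 (G : sgraph) (x : G) : {set G} := [set y | (y == x) || adj x y].

Lemma card_B1 (G : sgraph) D (x : G) : regular G D -> #|B1 x| = D.+1.
Proof.
move=> /(_ x) <-; rewrite (cardsD1 x) inE eqxx add1n; congr _.+1.
apply: eq_card => y; rewrite !inE; case: eqVneq => //= ->.
by rewrite adj_irr.
Qed.

(** By symmetry of [adj] the one-sided inequality bounds the difference both ways. Integer values
    suffice, since all test functions are combinations of distances and indicator functions. *)
Definition lipschitz1 (G : sgraph) (f : G -> int) : Prop :=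
  forall u v : G, adj u v -> f v <= f u + 1.

Section Transport.
Variables (R : realType) (G : sgraph).
Hypothesis Gc : connected_graph G.

Definition cost (pi : G -> G -> R) : R :=
  \sum_(x : G) \sum_(y : G) (dist x y)%:R * pi x y.

Lemma kantorovich_le (mu1 mu2 : G -> R) pi (f : G -> int) :
  coupling mu1 mu2 pi -> lipschitz1 f ->
  \sum_v (f v)%:~R * mu2 v - \sum_v (f v)%:~R * mu1 v <= cost pi.
Proof.
case=> pi01 m1 m2 fl.
under eq_bigr => v _ do rewrite -m2 mulr_sumr.
rewrite exchange_big /= -sumrB.
apply: ler_sum => u _; rewrite -m1 mulr_sumr -sumrB; apply: ler_sum => v _.
rewrite -mulrBl ler_wpM2r //; first by case/andP: (pi01 u v).
by rewrite -intrB -[leRHS]/((dist u v)%:Z%:~R) ler_int lerBlDl lip_dist.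
Qed.

Lemma cost_lbound (mu1 mu2 : G -> R) :
  has_lbound [set cost pi | pi in [set pi | coupling mu1 mu2 pi]]%classic.
Proof.
exists 0 => _ [pi [pi01 _ _] <-]; apply: sumr_ge0 => x _.
by apply: sumr_ge0 => y _; rewrite mulr_ge0 //; case/andP: (pi01 x y).
Qed.

Lemma W1_le (mu1 mu2 : G -> R) pi : coupling mu1 mu2 pi -> W1 mu1 mu2 <= cost pi.
Proof. by move=> cpi; apply: (ge_inf (cost_lbound _ _)); exists pi. Qed.

Lemma W1_ge (mu1 mu2 : G -> R) pi (f : G -> int) :
  coupling mu1 mu2 pi -> lipschitz1 f ->
  \sum_v (f v)%:~R * mu2 v - \sum_v (f v)%:~R * mu1 v <= W1 mu1 mu2.
Proof.
move=> cpi fl; apply: lb_le_inf; first by exists (cost pi), pi.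
by move=> _ [pi' cpi' <-]; apply: kantorovich_le.
Qed.

(** Provides a coupling at all: without one, [W1] would be an infimum over the empty set and [W1_ge]
    could not be applied. *)
Lemma product_coupling (mu1 mu2 : G -> R) :
  (forall x, 0 <= mu1 x) -> (forall x, 0 <= mu2 x) ->
  \sum_x mu1 x = 1 -> \sum_x mu2 x = 1 ->
  coupling mu1 mu2 (fun x y => mu1 x * mu2 y).
Proof.
move=> p1 p2 s1 s2.
have le1 mu (x : G) : (forall x, 0 <= mu x) -> \sum_x mu x = 1 -> mu x <= 1 :> R.
  by move=> p <-; rewrite (bigD1 x) //= lerDl sumr_ge0.
split=> [x y|x|y]; last by rewrite -mulr_suml s1 mul1r.
  by rewrite mulr_ge0 //= mulr_ile1 // le1.
by rewrite -mulr_sumr s2 mulr1.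
Qed.

Variable D : nat.
Hypothesis Greg : regular G D.
Implicit Types x y z : G.

Lemma ball_measureE x z : ball_measure R D x z = (z \in B1 x)%:R / D.+1%:R.
Proof.
by rewrite /ball_measure dist_le1 // inE; case: ifP; rewrite ?mul1r ?mul0r.
Qed.

Lemma sum_ball (f : G -> int) x :
  \sum_v (f v)%:~R * ball_measure R D x v = (\sum_(v in B1 x) f v)%:~R / D.+1%:R.
Proof.
rewrite rmorph_sum /= mulr_suml [RHS]big_mkcond; apply: eq_bigr => v _.
by rewrite ball_measureE; case: ifP; rewrite ?mul1r ?mul0r ?mulr0.
Qed.

Lemma ball_sum1 x : \sum_v ball_measure R D x v = 1.
Proof.
have := sum_ball (fun=> 1) x; under eq_bigr do rewrite mul1r.
by move->; rewrite sumr_const (card_B1 _ Greg) natz divff // pnatr_eq0.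
Qed.

Lemma ball_coupling x y :
  exists pi, coupling (ball_measure R D x) (ball_measure R D y) pi.
Proof.
eexists; apply: product_coupling; rewrite ?ball_sum1 // => v;
  by rewrite ball_measureE mulr_ge0 ?invr_ge0 ?ler0n.
Qed.

Lemma W1_ball_ge x y (f : G -> int) : lipschitz1 f ->
  (\sum_(v in B1 y) f v - \sum_(v in B1 x) f v)%:~R / D.+1%:R
    <= W1 (ball_measure R D x) (ball_measure R D y).
Proof.
move=> fl; have [pi cpi] := ball_coupling x y.
by have := W1_ge cpi fl; rewrite !sum_ball -mulrBl -intrB.
Qed.

Lemma inf_curvature_le x y : adj x y -> inf_curvature R G D <= curvature R D x y.
Proof.
move=> xy; apply: ge_inf; last by exists x, y.
(* A crude lower bound that works for all of the finitely many pairs at once. *)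
exists (- \sum_(u : G) \sum_(v : G) `|curvature R D u v|) => _ [u [v [_ ->]]].
rewrite lerNl (bigD1 u) //= (bigD1 v) //=.
rewrite -addrA ler_wpDr ?addr_ge0 ?sumr_ge0 // => [*|]; first by rewrite sumr_ge0.
by rewrite -normrN ler_norm.
Qed.

End Transport.

(* Only the easy half of Kantorovich duality is needed to get this from sharpness. *)
Definition transport_bound (G : sgraph) (D : nat) : Prop :=
  forall z w : G, adj z w -> forall f : G -> int, lipschitz1 f ->
  3 * (\sum_(v in B1 w) f v - \sum_(v in B1 z) f v) <= D%:Z + 3.

(** With diameter 3 the infimum of the curvature is 2/3, so [W1] is at most (D + 3) / (3 (D + 1))
    along each edge, while any test function bounds [W1] from below. *)
Lemma sharp_transport_bound (R : realType) (G : sgraph) :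
  connected_graph G -> bonnet_myers_sharp R G -> diam G = 3%N ->
  exists D, [/\ (0 < D)%N, regular G D & transport_bound G D].
Proof.
move=> Gc [D [Greg K0 dK]] d3; exists D.
have KE : inf_curvature R G D = 2 / 3.
  move: dK; rewrite d3 => h.
  have: 3 * inf_curvature R G D = 2 by rewrite h -mulrA mulVf ?mulr1 // gt_eqF.
  by move=> h3; apply: (canRL (mulfK _)); rewrite ?pnatr_eq0 // mulrC.
(* For D = 0 there are no edges, and the infimum over the empty set is 0, not positive. *)
have D0 : (0 < D)%N.
  rewrite lt0n; apply/eqP => D0; move: K0; rewrite /inf_curvature.
  suff -> : [set k | exists x y : G, adj x y /\ k = curvature R D x y]%classic =
    classical_sets.set0.
    by rewrite inf0 ltxx.
  rewrite -classical_sets.subset0 => k [x [y [xy _]]].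
  move: (Greg x); rewrite D0 => /eqP; rewrite -leqn0 leqNgt => /negP; apply.
  by apply/card_gt0P; exists y.
split=> // z w zw f fl.
have := inf_curvature_le R D zw; rewrite KE /curvature.
have := W1_ball_ge R Gc Greg z w fl.
set s := (X in X%:~R / _ <= _); set W := W1 _ _ => h1 h2.
have D0' : 0 < D%:R :> R by rewrite ltr0n.
have D1' : 0 < D.+1%:R :> R by rewrite ltr0n.
rewrite -(ler_int R) intrM intrD.
have {h2} : 2 / 3 * D%:R <= D.+1%:R * (1 - W).
  by have := ler_wpM2r (ltW D0') h2; rewrite [leRHS]mulrAC divfK ?gt_eqF.
move: h1; rewrite ler_pdivrMr // -natr1 => h1 h2.
rewrite -[D%:~R]/(D%:R : R) -[3%:~R]/(3%:R:R).
move: h1 h2; set a := s%:~R; set d := D%:R => h1 h2; nra.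
Qed.

(** * Distance levels *)

Lemma sum_cst (T : finType) (c : int) : \sum_(v : T) c = #|T|%:Z * c.
Proof. by rewrite sumr_const -mulr_natl natz. Qed.

Section Levels.
Variables (G : sgraph) (D : nat).
Hypotheses (Gc : connected_graph G) (D0 : (0 < D)%N).
Hypotheses (Greg : regular G D) (GT : transport_bound G D).
Implicit Types x y z v w : G.

Lemma transport_bound_dist (f : G -> int) z w : lipschitz1 f ->
  3 * (\sum_(v in B1 w) f v - \sum_(v in B1 z) f v)
    <= (dist z w)%:Z * (D%:Z + 3).
Proof.
move=> fl; have [p [pp <- <-]] := dist_path Gc z w.
elim: p z pp => [|u p IH] z /=; first by rewrite subrr mulr0.
case/andP=> zu /IH; have := GT zu fl.
rewrite [Posz (size p).+1]intS mulrDl mul1r.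
set a := \sum_(v in _) _; set b := \sum_(v in _) _; set c := \sum_(v in _) _.
set t := _ * _; lia.
Qed.

Lemma mem_B1_sym x y : (x \in B1 y) = (y \in B1 x).
Proof. by rewrite !inE eq_sym adj_sym. Qed.

(** Double count: each vertex lies in D + 1 balls. *)
Lemma sum_B1_sum (f : G -> int) :
  \sum_z \sum_(v in B1 z) f v = D.+1%:Z * \sum_v f v.
Proof.
rewrite (exchange_big_dep predT) //= mulr_sumr; apply: eq_bigr => v _.
rewrite sumr_const -(card_B1 v Greg) -mulr_natl natz; congr (Posz _ * _).
by apply: eq_card => z; rewrite -mem_B1_sym.
Qed.

Lemma lipschitz1_dist x : lipschitz1 (fun v => (dist x v)%:Z).
Proof. by move=> u v /(dist_adjr Gc x); lia. Qed.

Lemma sum_dist_B1 x : \sum_(v in B1 x) (dist x v)%:Z = D%:Z.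
Proof.
rewrite (bigD1 x) ?inE ?eqxx //= dist_xx add0r -(Greg x).
rewrite (eq_bigr (fun=> 1)) => [|v /andP[+ vx]]; last first.
  by rewrite inE (negPf vx) /= -(dist_eq1 Gc) => /eqP ->.
rewrite sumr_const natz; congr Posz; apply: eq_card => v.
rewrite unfold_in /= !inE; case: eqVneq => [->|]; first by rewrite adj_irr.
by rewrite andbT.
Qed.

Lemma sum_dist_bound x z :
  3 * (\sum_(v in B1 z) (dist x v)%:Z) <= 3 * D%:Z + (dist x z)%:Z * (D%:Z + 3).
Proof.
have := transport_bound_dist x z (lipschitz1_dist x).
rewrite sum_dist_B1; set t := _ * _; lia.
Qed.

(** Sum [sum_dist_bound] over all [z]. With S the sum of the distances and N the number of vertices,
    3 (D + 1) S <= 3 D N + (D + 3) S, that is 2 D S <= 3 D N, and D cancels. *)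
Lemma sum_dist_le x : 2 * \sum_v (dist x v)%:Z <= 3 * #|G|%:Z.
Proof.
have : \sum_z 3 * (\sum_(v in B1 z) (dist x v)%:Z) <=
  \sum_z (3 * D%:Z + (dist x z)%:Z * (D%:Z + 3)).
  by apply: ler_sum => z _; apply: sum_dist_bound.
rewrite -mulr_sumr sum_B1_sum big_split /= sum_cst -mulr_suml.
set s := \sum_v _; rewrite [Posz D.+1]intS; move: D0; rewrite -ltz_nat.
set d := Posz D; set n := Posz #|_| => d0 h.
by rewrite -(ler_pM2l d0); move: h; lia.
Qed.

Variables x y : G.
Hypothesis xy3 : dist x y = 3%N.

(* Summing [dist x v + dist y v >= 3] over the graph against the two upper bounds
   of [sum_dist_le] forces equality everywhere. *)
Lemma antipodal_dist z : (dist x z + dist y z = 3)%N.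
Proof.
have ge3 v : (3 <= dist x v + dist y v)%N.
  by rewrite -xy3 (dist_sym Gc y v) dist_triangle.
have s0 : \sum_v ((dist x v)%:Z + (dist y v)%:Z - 3) = 0.
  apply/eqP; rewrite eq_le; apply/andP; split; last first.
    by apply: sumr_ge0 => v _; have := ge3 v; lia.
  rewrite sumrB big_split /= sum_cst.
  move: (sum_dist_le x) (sum_dist_le y).
  set a := \sum_v (dist x v)%:Z; set b := \sum_v (dist y v)%:Z; lia.
have := psumr_eq0P _ s0 => /(_ _ z isT); have := ge3 z.
by move=> _ h; have : (dist x z)%:Z + (dist y z)%:Z - 3 = 0; [apply: h => v _;
  have := ge3 v|]; lia.
Qed.

(** By [antipodal_dist] the distance sums of [x] and [y] add up to 3N, so both attain the bound of
    [sum_dist_le]. The slacks in [sum_dist_bound] are then nonnegative with sum zero. *)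
Lemma sum_dist_eq z :
  3 * (\sum_(v in B1 z) (dist x v)%:Z) = 3 * D%:Z + (dist x z)%:Z * (D%:Z + 3).
Proof.
have s0 : \sum_z (3 * D%:Z + (dist x z)%:Z * (D%:Z + 3)
    - 3 * (\sum_(v in B1 z) (dist x v)%:Z)) = 0.
  rewrite sumrB -mulr_sumr sum_B1_sum big_split /= sum_cst -mulr_suml.
  have : 2 * \sum_v (dist x v)%:Z = 3 * #|G|%:Z :> int.
    have : \sum_v ((dist x v)%:Z + (dist y v)%:Z) = 3 * #|G|%:Z :> int.
      under eq_bigr do rewrite -PoszD antipodal_dist.
      by rewrite sum_cst mulrC.
    have aux (a b n : int) : 2 * a <= 3 * n -> 2 * b <= 3 * n -> a + b = 3 * n ->
        2 * a = 3 * n by lia.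
    by rewrite big_split; apply: aux; exact: sum_dist_le.
  have aux (s d n : int) : 2 * s = 3 * n ->
      n * (3 * d) + s * (d + 3) - 3 * ((1 + d) * s) = 0.
    move=> h; have -> : n * (3 * d) = d * (3 * n) by ring.
    by rewrite -h; ring.
  by rewrite [Posz D.+1]intS; apply: aux.
by apply/esym/eqP; rewrite -subr_eq0; apply/eqP; apply: (psumr_eq0P _ s0) => // v _;
  rewrite subr_ge0 sum_dist_bound.
Qed.

End Levels.

(** * Local structure *)

Definition nb (G : sgraph) (x : G) : {set G} := [set y | adj x y].

(** For [a] adjacent to [x], these are the points collinear to [a] in the quadrangle on the
    neighbours of [x]. *)
Definition nonnb (G : sgraph) (x a : G) : {set G} := nb x :\: B1 a.

(** What equality in the transport estimates leaves, with D = 3k. The conditions are symmetric in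
    [x] and [y], so every consequence also holds with the two ends exchanged. *)
Record antipodal_levels (G : sgraph) (k : nat) (x y : G) : Prop := {
  al_conn : connected_graph G;
  al_reg : regular G (3 * k)%N;
  al_dist : forall z : G, (dist x z + dist y z = 3)%N;
  al_suml : forall z : G, \sum_(v in B1 z) (dist x v)%:Z
    = (3 * k + dist x z * k.+1)%N%:Z;
  al_sumr : forall z : G, \sum_(v in B1 z) (dist y v)%:Z
    = (3 * k + dist y z * k.+1)%N%:Z;
  al_bound : forall z w : G, adj z w -> forall f, lipschitz1 f ->
    \sum_(v in B1 w) f v - \sum_(v in B1 z) f v <= k.+1%:Z }.

Lemma antipodal_levels_sym (G : sgraph) k (x y : G) :
  antipodal_levels k x y -> antipodal_levels k y x.
Proof. by case=> *; split=> // z; rewrite addnC. Qed.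

Lemma sum_indicator (T : finType) (S U : {set T}) :
  \sum_(v in S) (v \in U)%:Z = #|S :&: U|%:Z.
Proof.
rewrite -sum1_card -[RHS]natz natr_sum /= big_mkcond [RHS]big_mkcond /=.
by apply: eq_bigr => v _; rewrite inE; case: (v \in S); case: (v \in U).
Qed.

Section LocalStructure.
Variables (G : sgraph) (k : nat) (x y : G).
Hypothesis L : antipodal_levels k x y.

Local Notation A := (nb x).
Local Notation B := (nb y).
Local Notation C := (nonnb x).
Let Gc := al_conn L.
Implicit Types a b v w : G.

Lemma nb_distl v : (v \in A) = (dist x v == 1)%N.
Proof. by rewrite inE dist_eq1. Qed.

Lemma nb_distr v : (v \in B) = (dist x v == 2)%N.
Proof. by rewrite inE -dist_eq1 //; have := al_dist L v; lia. Qed.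

Lemma card_nb v : #|nb v| = (3 * k)%N.
Proof. by rewrite -(al_reg L v); apply: eq_card => w; rewrite !inE. Qed.

Lemma cardB1 v : #|B1 v| = (3 * k).+1.
Proof. exact: card_B1 (al_reg L). Qed.

Lemma card_nb_cross a : a \in A -> #|nb a :&: B| = k.+1.
Proof.
move=> aA; have da : dist x a = 1%N by apply/eqP; rewrite -nb_distl.
have := al_suml L a; rewrite da mul1n.
(* The ball around [a] meets only the levels 0, 1 and 2, and level 0 is [x] alone; hence [al_suml]
   counts the neighbours in [B]. *)
rewrite (eq_bigr (fun v => 1 + (v \in B)%:Z - (v \in [set x])%:Z)); last first.
  move=> v; rewrite nb_distr !inE -(dist_eq0 Gc v x) => h.
  have : (dist x v <= 2)%N.
    case/orP: h => [/eqP ->|/(dist_adjr Gc x)]; by rewrite da.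
  by rewrite (dist_sym Gc v); case: (dist x v) => [|[|[|]]].
rewrite sumrB big_split /= !sum_indicator sumr_const cardB1 natz.
have -> : B1 a :&: [set x] = [set x].
  by apply/setIidPr; rewrite sub1set !inE adj_sym; move: aA; rewrite inE => ->;
    rewrite orbT.
rewrite cards1; have -> : B1 a :&: B = nb a :&: B.
  apply/setP => v; rewrite [in RHS]inE [in LHS]inE nb_distr !inE.
  by case: eqVneq => [->|//]; rewrite da !andbF.
by set n := #|_|; lia.
Qed.

(** The ball around [a] consists of [x], k + 1 vertices of [B] and hence 2k - 1 vertices of [A],
    which leaves k + 1 of the 3k vertices of [A]. *)
Lemma card_nonnb a : a \in A -> #|C a| = k.+1.
Proof.
move=> aA; have := card_nb_cross aA; have := cardB1 a.
have -> : B1 a = [set x] :|: (A :&: B1 a) :|: (nb a :&: B).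
  apply/setP => v; rewrite !in_setU in_set1 !in_setI nb_distl nb_distr !inE.
  have da : dist x a = 1%N by apply/eqP; rewrite -nb_distl.
  rewrite (eq_sym v x) -(dist_eq0 Gc x v).
  case: eqVneq => [->|/= ne]; first by rewrite da.
  case av : (adj a v) => /=; last by rewrite !andbF orbF; move: aA av;
    rewrite inE adj_sym => xa; rewrite (dist_eq0 Gc); case: eqVneq => // <-; rewrite xa.
  by have := dist_adjr Gc x av; rewrite da andbT; case: (dist x v) => [|[|[|]]].
have xA : x \notin A by rewrite inE adj_irr.
have := cardsID (B1 a) A; rewrite card_nb.
rewrite !cardsU cards1.
have -> : [set x] :&: (A :&: B1 a) = finset.set0.
  by apply/eqP; rewrite setI_eq0 disjoints1 inE (negPf xA).
have -> : ([set x] :|: A :&: B1 a) :&: (nb a :&: B) = finset.set0.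
  apply/setP => v; rewrite !(in_setI, in_setU) in_set1 nb_distl nb_distr in_set0.
  by case: eqVneq => [->|_] /=; rewrite ?dist_xx ?andbF //;
    case: (dist x v) => [|[|[|]]] //=; rewrite ?andbF.
rewrite !cards0 /nonnb; set u := #|A :&: _|; set w := #|A :\: _|; lia.
Qed.

Lemma nonnbE a v : (v \in C a) = [&& adj x v, v != a & ~~ adj a v].
Proof. by rewrite !inE negb_or andbC. Qed.

Lemma nonnb_sym a v : a \in A -> v \in A -> (v \in C a) = (a \in C v).
Proof. by rewrite !nonnbE !inE => -> ->; rewrite eq_sym adj_sym. Qed.

Lemma nonnb_sub a v : v \in C a -> v \in A.
Proof. by rewrite inE => /andP[]. Qed.

(** Every indicator function is 1-Lipschitz; the one of the set in question serves as test
    function. *)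
Lemma card_B1D_le z w : adj z w -> (#|B1 w :\: B1 z| <= k.+1)%N.
Proof.
move=> zw; have lf : lipschitz1 (fun v => (v \in B1 w :\: B1 z)%:Z).
  by move=> u v _; do 2!case: (_ \in _).
have := al_bound L zw lf; rewrite !sum_indicator lerBlDr.
have -> : B1 z :&: (B1 w :\: B1 z) = finset.set0.
  by apply/setP => v; rewrite !inE; case: (_ || _); rewrite ?andbF.
have -> : B1 w :&: (B1 w :\: B1 z) = B1 w :\: B1 z.
  by apply/setIidPr; rewrite subsetDl.
by rewrite cards0; lia.
Qed.

(* Test function: [max (dist x v) 1], raised by one on the set to be bounded. *)
Lemma card_nonnb_nb a b : a \in A -> b \in B -> adj a b ->
  (#|nb b :&: C a| <= 1)%N.
Proof.
move=> aA bB ab; set T := nb b :&: C a.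
have da : dist x a = 1%N by apply/eqP; rewrite -nb_distl.
have db : dist x b = 2%N by apply/eqP; rewrite -nb_distr.
have TA v : v \in T -> dist x v = 1%N.
  by rewrite inE => /andP[_ /nonnb_sub]; rewrite nb_distl => /eqP.
have lf : lipschitz1 (fun v => (dist x v)%:Z + (v \in [set x])%:Z + (v \in T)%:Z).
  move=> u v uv; have h1 := dist_adjr Gc x uv.
  have h2 : (dist x u <= (dist x v).+1)%N by rewrite (dist_adjr Gc) // adj_sym.
  rewrite !in_set1 -!(dist_eq0 Gc) !(dist_sym Gc _ x).
  have := TA v; have := TA u.
  case: (u \in T) => [/(_ isT) hu|_]; case: (v \in T) => [/(_ isT) hv|_];
    do 2!case: eqP; lia.
have := al_bound L ab lf; rewrite !big_split /= !sum_indicator !(al_suml L) da db.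
have -> : B1 b :&: [set x] = finset.set0.
  apply/eqP; rewrite setIC setI_eq0 disjoints1 inE negb_or -(dist_eq1 Gc).
  by rewrite (dist_sym Gc) db -(dist_eq0 Gc) db.
have -> : B1 a :&: [set x] = [set x].
  by apply/setIidPr; rewrite sub1set !inE adj_sym; move: aA; rewrite inE => ->;
    rewrite orbT.
have -> : B1 b :&: T = T.
  by apply/setIidPr/subsetP => v; rewrite !inE => /andP[->]; rewrite orbT.
have -> : B1 a :&: T = finset.set0.
  by apply/setP => v; rewrite !inE; case: (_ || _); rewrite ?andbF.
rewrite cards1 cards0; set t := #|_|; lia.
Qed.

Lemma nonnb_common a a' : a \in A -> a' \in C a ->
  exists b, [/\ b \in B, adj a b & adj a' b].
Proof.
move=> aA a'C; have a'A := nonnb_sub a'C.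
have xa : adj x a by move: aA; rewrite inE.
case: (pickP [pred b | [&& b \in B, adj a b & adj a' b]]) => [b /and3P[]|no].
  by exists b.
(* The values 1 and -1 never occur on adjacent vertices if there is no common neighbour. Along the
   edge from [x] to [a] the ball sum would then rise by (k + 1) + 1, too much. *)
have lf : lipschitz1 (fun v => (v \in nb a :&: B)%:Z - (v \in [set a'])%:Z).
  move=> u v uv; rewrite !in_set1; case: (eqVneq u a') => [ua|]; last first.
    by case: (v \in _); case: (u \in _); case: (v == a').
  have -> : v \in nb a :&: B = false.
    apply/negbTE; rewrite !inE; apply/negP => /andP[av yv].
    by have := no v; rewrite /= !inE yv av -ua uv.
  by case: (u \in _); case: (v == a').
have := al_bound L xa lf; rewrite !sumrB !sum_indicator.
have -> : B1 a :&: [set a'] = set0.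
  by apply/eqP; rewrite setIC setI_eq0 disjoints1; move: a'C; rewrite !inE => /andP[].
have -> : B1 x :&: [set a'] = [set a'].
  by apply/setIidPr; rewrite sub1set; move: a'A; rewrite !inE => ->; rewrite orbT.
have -> : B1 x :&: (nb a :&: B) = set0.
  apply/setP => v; rewrite !in_setI nb_distr in_set0 inE -(dist_eq0 Gc) (dist_sym
    Gc v) -(dist_eq1 Gc).
  by case: (dist x v) => [|[|[|]]] //=; rewrite ?andbF.
have -> : B1 a :&: (nb a :&: B) = nb a :&: B.
  by apply/setIidPr/subsetP => v; rewrite !inE => /andP[->]; rewrite orbT.
rewrite card_nb_cross // cards1 !cards0; lia.
Qed.

End LocalStructure.

Lemma transport_levels (G : sgraph) D (x y : G) :
  connected_graph G -> (0 < D)%N -> regular G D -> transport_bound G D ->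
  dist x y = 3%N -> exists k, (0 < k)%N /\ antipodal_levels k x y.
Proof.
move=> Gc D0 Greg GT xy3.
have yx3 : dist y x = 3%N by rewrite dist_sym.
have Ex := sum_dist_eq Gc D0 Greg GT xy3; have Ey := sum_dist_eq Gc D0 Greg GT yx3.
have /card_gt0P[a] : (0 < #|[pred v | adj x v]|)%N by rewrite Greg.
rewrite inE -(dist_eq1 Gc) => /eqP xa.
pose k := (D %/ 3)%N; have Dk : D = (3 * k)%N.
  by have := Ex a; rewrite xa; set s := \sum_(v in _) _ => h; rewrite /k; lia.
exists k; split; first by lia.
split=> //.
- by rewrite -Dk.
- by move=> z; rewrite (antipodal_dist Gc D0 Greg GT xy3).
- move=> z; apply: (mulfI (x := 3)) => //.
  by rewrite Ex Dk !(PoszD, PoszM) intS; ring.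
- move=> z; apply: (mulfI (x := 3)) => //.
  by rewrite Ey Dk !(PoszD, PoszM) intS; ring.
by move=> z w zw f fl; have := GT z w zw f fl; rewrite Dk;
  set s := \sum_(v in _) _; set t := \sum_(v in _) _; lia.
Qed.

(** * The quadrangle in the neighbourhood of a vertex *)

Lemma sum_card_inter (T : finType) (S U : {set T}) (e : T -> {set T}) (X : {set T}) :
  (forall v w, v \in S -> w \in U -> (w \in e v) = (v \in e w)) -> X \subset U ->
  (\sum_(v in S) #|X :&: e v| = \sum_(w in X) #|e w :&: S|)%N.
Proof.
move=> es XU.
under eq_bigr => v _ do rewrite -sum1_card.
rewrite (exchange_big_dep (mem X)) /=; last by move=> v w _; rewrite inE => /andP[].
apply: eq_bigr => w wX; rewrite -sum1_card; apply: eq_bigl => v.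
rewrite !inE wX /= andbC; case vS: (v \in S); rewrite ?andbF // ?andbT.
by rewrite es // (subsetP XU).
Qed.

Section LocalQuadrangle.
Variables (G : sgraph) (k : nat) (x y : G).
Hypothesis L : antipodal_levels k x y.
Local Notation A := (nb x).
Local Notation B := (nb y).
Local Notation C := (nonnb x).
Let Gc := al_conn L.
Let L' := antipodal_levels_sym L.
Implicit Types a b v w : G.

Lemma mem_nbC v w : (v \in nb w) = (w \in nb v).
Proof. by rewrite !inE adj_sym. Qed.

Lemma nonnb_notself a : a \notin C a.
Proof. by rewrite nonnbE eqxx andbF. Qed.

Lemma card_nb_crossl b : b \in B -> #|nb b :&: A| = k.+1.
Proof. exact: card_nb_cross L' _. Qed.

(* The common neighbour [b] in [B] of [a] and [a'] has k - 1 further neighbours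
   in [A], and by [card_nonnb_nb] none of them is in [C a] or [C a']. *)
Lemma card_nonnbI_gt0 a a' : a \in A -> a' \in C a -> (0 < #|C a :&: C a'|)%N.
Proof.
move=> aA a'C; have a'A := nonnb_sub a'C.
have [b [bB ab a'b]] := nonnb_common L aA a'C.
have := card_nonnb_nb L aA bB ab; have := card_nonnb_nb L a'A bB a'b.
have := card_nb_crossl bB; have := card_nonnb L aA; have := card_nonnb L a'A.
have := cardsUI (C a) (C a').
set T := nb b :&: A; move=> h1 h2 h3 h4 h5 h6.
have : (#|T| <= #|nb b :&: C a| + #|nb b :&: C a'| + #|A :\: (C a :|: C a')|)%N.
  apply: leq_trans (leq_add (leq_card_setU _ _) (leqnn _)).
  apply: leq_trans (leq_card_setU _ _); apply: subset_leq_card.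
  apply/subsetP => t; rewrite in_setI => /andP[tb tA].
  by rewrite !in_setU !in_setI in_setD in_setU tb tA; case: (t \in C a);
    case: (t \in C a').
have := cardsID (C a :|: C a') A; rewrite (card_nb L).
have -> : A :&: (C a :|: C a') = C a :|: C a'.
  by apply/setIidPr; rewrite subUset !subsetDl.
rewrite h4 in h5 *; move: h1 h2 h3 h6; lia.
Qed.

(* A vertex of [B1 a' :\: B1 a] inside [A] is in [C a :\: C a']. *)
Lemma card_common_ge a a' : a \in A -> a' \in A -> adj a a' ->
  (k.+1 <= #|C a :&: C a'| + #|nb a :&: B :&: nb a'|)%N.
Proof.
move=> aA a'A aa'; have := card_B1D_le L aa'.
have := card_nonnb L aA; have := card_nb_cross L a'A.
have : (#|C a :\: C a'| + #|(nb a' :&: B) :\: nb a| <= #|B1 a' :\: B1 a|)%N.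
  have /eqP <- : #|(C a :\: C a') :|: ((nb a' :&: B) :\: nb a)|
      == (#|C a :\: C a'| + #|(nb a' :&: B) :\: nb a|)%N.
    rewrite (leq_card_setU _ _) disjoints_subset; apply/subsetP => v.
    rewrite !in_setD in_setC in_setD in_setI => /andP[_ /andP[_]].
    by rewrite (nb_distl L) (nb_distr L) => /eqP ->; rewrite !andbF.
  apply: subset_leq_card; apply/subsetP => v; rewrite in_setU => /orP[].
    by rewrite !inE; case: (v == a); case: (adj a v); case: (adj x v);
      rewrite ?andbF ?andbT ?negbK.
  rewrite in_setD in_setI (nb_distr L) => /and3P[nav a'v dv].
  have va : v != a.
    by apply: contraTneq dv => ->; move: aA; rewrite (nb_distl L) => /eqP ->.
  by move: nav a'v; rewrite !inE (negPf va) => -> ->; rewrite orbT.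
have := cardsID (C a') (C a); have := cardsID (nb a) (nb a' :&: B).
rewrite setIAC [nb a' :&: nb a]setIC setIAC.
set p := #|_|; set q := #|_|; set r := #|_|; set s := #|_|; set t := #|_|;
  set u := #|_|.
lia.
Qed.

(** [low] bounds [h] below: by 2 on [C a], since both terms are positive, and by k + 1 on the
    neighbours of [a] via [card_common_ge]. A double count shows that both have sum 2 (k + 1)^2 over
    [A], so [h] equals [low] everywhere, and on [C a] both terms are 1. *)
Lemma common_card1 a a' : a \in A -> a' \in C a ->
  #|C a :&: C a'| = 1%N /\ #|nb a :&: B :&: nb a'| = 1%N.
Proof.
move=> aA a'C.
pose h v := (#|C a :&: C v| + #|nb a :&: B :&: nb v|)%N.
pose low v := (if v == a then k.+1.*2 else if v \in C a then 2 else k.+1)%N.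
have lowP v : v \in A -> (low v <= h v)%N.
  move=> vA; rewrite /low /h; case: eqVneq => [->|va].
    rewrite setIid setIAC setIid (card_nonnb L aA) (card_nb_cross L aA); lia.
  case: ifP => vC.
    have := card_nonnbI_gt0 aA vC.
    have [b [bB ab vb]] := nonnb_common L aA vC.
    suff : (0 < #|nb a :&: B :&: nb v|)%N by lia.
    by apply/card_gt0P; exists b; rewrite !inE ab vb; move: bB; rewrite inE => ->.
  apply: card_common_ge => //; move: vC; rewrite nonnbE; move: vA.
  by rewrite inE => -> /=; rewrite va => /negbFE.
have sumh : (\sum_(v in A) h v = \sum_(v in A) low v)%N.
  rewrite /h big_split /= (@sum_card_inter _ A A C); last exact: subsetDl.
    rewrite (@sum_card_inter _ A B (@nb G)); last exact: subsetIr.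
      have -> : (\sum_(w in C a) #|C w :&: A| = k.+1 * k.+1)%N.
        rewrite (eq_bigr (fun=> k.+1)) ?sum_nat_const ?(card_nonnb L aA) // => v
          /nonnb_sub vA.
        by rewrite (setIidPl _) ?subsetDl // (card_nonnb L vA).
      have -> : (\sum_(w in nb a :&: B) #|nb w :&: A| = k.+1 * k.+1)%N.
        rewrite (eq_bigr (fun=> k.+1)) ?sum_nat_const ?(card_nb_cross L aA) // => v.
        by rewrite inE => /andP[_ vB]; rewrite card_nb_crossl.
      rewrite (bigD1 a) //= {1}/low eqxx.
      rewrite (bigID (mem (C a))) /=.
      rewrite (eq_bigr (fun=> 2)); last by move=> v /andP[/andP[_ va] vC];
        rewrite /low (negPf va) vC.
      rewrite sum_nat_const (eq_bigr (fun=> k.+1)); last first.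
        by move=> v /andP[/andP[_ va] vC]; rewrite /low (negPf va) (negPf vC).
      rewrite sum_nat_const.
      have -> : #|[pred v | (v \in A) && (v != a) && (v \in C a)]| = k.+1.
        rewrite -(card_nonnb L aA); apply: eq_card => v; rewrite !inE.
        by case: (eqVneq v a) => [->|]; rewrite ?eqxx ?andbF //= ?andbT;
          case: (adj x v); rewrite ?andbF.
      have -> : #|[pred v | (v \in A) && (v != a) && (v \notin C a)]| = (2 * k - 2)%N.
        have := cardsID (C a) (A :\ a); have := cardsD1 a A.
        rewrite aA (card_nb L).
        have -> : (A :\ a) :&: C a = C a.
          apply/setIidPr/subsetP => v vC; rewrite in_setD1 (nonnb_sub vC) andbT.
          by apply: contraTneq vC => ->; apply: nonnb_notself.
        rewrite (card_nonnb L aA) => h1 h2.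
        have -> : #|[pred v | (v \in A) && (v != a) && (v \notin C a)]| = #|(A :\
          a) :\: C a|.
          apply: eq_card => v; rewrite in_setD in_setD1 unfold_in /=.
          by rewrite andbC [(v \in A) && _]andbC.
        by move: h1 h2; set p := #|_|; set q := #|_|; lia.
      have k0 : (0 < k)%N.
        by have := card_nb L x; rewrite (cardsD1 a) aA; set p := #|_|; lia.
      by rewrite -muln2; nia.
    by move=> v w _ _; rewrite mem_nbC.
  by move=> v w vA wA; rewrite nonnb_sym.
have a'A := nonnb_sub a'C.
have : (h a' <= low a')%N.
  move: sumh; rewrite (bigD1 a') //= [RHS](bigD1 a') //= => sumh.
  have : (\sum_(v in A | v != a') low v <= \sum_(v in A | v != a') h v)%N.
    by apply: leq_sum => v /andP[vA _]; apply: lowP.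
  by move: sumh; set p := (\sum_(_ in _ | _) _)%N;
    set q := (\sum_(_ in _ | _) _)%N; lia.
rewrite /low /h a'C; have := card_nonnbI_gt0 aA a'C.
have [b [bB ab vb]] := nonnb_common L aA a'C.
have : (0 < #|nb a :&: B :&: nb a'|)%N.
  by apply/card_gt0P; exists b; rewrite !inE ab vb; move: bB; rewrite inE => ->.
have -> : a' == a = false by apply/negbTE; apply: contraTneq a'C => ->;
  apply: nonnb_notself.
by move=> *; split; lia.
Qed.

(* Each of the three points of a line has k + 1 collinear points, and the three
   sets pairwise share one point: together they exhaust the 3k points of [A]. *)
Lemma nonnb_cover a a' a'' d : a \in A -> a' \in C a -> a'' \in C a -> a'' \in C a' ->
  d \in A -> [|| d \in C a, d \in C a' | d \in C a''].
Proof.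
move=> aA a'C a''C a''C' dA; have a'A := nonnb_sub a'C; have a''A := nonnb_sub a''C.
have [h _] := common_card1 aA a'C; have [h' _] := common_card1 aA a''C.
have [h'' _] := common_card1 a'A a''C'.
suff /eqP e : (C a :|: C a') :|: C a'' == A by move: dA; rewrite -e !in_setU orbA.
rewrite eqEcard !subUset !subsetDl /= (card_nb L).
have := cardsUI (C a) (C a'); have := cardsUI (C a :|: C a') (C a'').
have : (#|(C a :|: C a') :&: C a''| <= #|C a :&: C a''| + #|C a' :&: C a''|)%N.
  by rewrite setIUl leq_card_setU.
rewrite !(card_nonnb L) // h h' h''; lia.
Qed.

(** Take a line through [p] and a common neighbour [b] of its other points [a], [a']. A neighbour of
    [b] in [A] is collinear to [p], [a] or [a']; in the last two cases [card_nonnb_nb] makes it [a']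
    or [a], again in [C p]. Equal cardinalities finish. *)
Lemma antipode_exists p : p \in A -> exists2 b, b \in B & nb b :&: A = C p.
Proof.
move=> pA.
have /card_gt0P[a aC] : (0 < #|C p|)%N by rewrite (card_nonnb L pA).
have aA := nonnb_sub aC; have pCa : p \in C a by rewrite nonnb_sym.
have /eqP/cards1P[a' e] := (common_card1 pA aC).1.
have : a' \in C p :&: C a by rewrite e set11.
rewrite in_setI => /andP[a'Cp a'Ca].
have a'A := nonnb_sub a'Ca.
have [b [bB ab a'b]] := nonnb_common L aA a'Ca.
exists b => //; apply/eqP; rewrite eqEcard (card_nb_crossl bB) (card_nonnb L pA)
  leqnn andbT.
have uniq1 u v t : u \in A -> adj u b -> v \in C u -> adj b v -> t \in C u -> adj b
  t -> t = v.
  move=> uA ub vC bv tC bt; apply: (card_le1_eqP (card_nonnb_nb L uA bB ub));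
  by rewrite in_setI inE ?bt ?bv.
apply/subsetP => t; rewrite in_setI inE => /andP[bt tA].
have ba' : adj b a' by rewrite adj_sym.
have ba : adj b a by rewrite adj_sym.
have aCa' : a \in C a' by rewrite nonnb_sym.
case/or3P: (nonnb_cover pA aC a'Cp a'Ca tA) => // [tC|tC].
  by rewrite (uniq1 a a' t).
by rewrite (uniq1 a' a t).
Qed.

End LocalQuadrangle.

(** * Antipodes *)

Section Antipodes.
Variables (G : sgraph) (k : nat) (x y : G).
Hypothesis L : antipodal_levels k x y.
Local Notation A := (nb x).
Local Notation B := (nb y).
Local Notation C := (nonnb x).
Implicit Types a b p v w : G.

(** Let [a] be the only common point and [q] the third point on its line with [p]. A second line
    through [p] also has a point collinear to [p'], necessarily [a]; but then it is the first
    line. *)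
Lemma noncollinear_common p p' : p \in A -> p' \in A -> p != p' -> p' \notin C p ->
  #|C p :&: C p'| != 1%N.
Proof.
move=> pA p'A pp' p'C; apply/negP => /cards1P[a e].
have : a \in C p :&: C p' by rewrite e set11.
rewrite in_setI => /andP[aC aC']; have aA := nonnb_sub aC.
have /eqP/cards1P[q e'] := (common_card1 L pA aC).1.
have : q \in C p :&: C a by rewrite e' set11.
rewrite in_setI => /andP[qC qCa].
(* For k = 1 there is no second line, but [p], [p'] and [C p] already give four points where [A] has
   three. *)
have [le2|] := leqP k.+1 2.
  have k1 : k = 1%N.
    by have := card_nb L x; rewrite (cardsD1 p) pA; move: le2; clear;
      set n := #|_|; lia.
  have : (#|p' |: (p |: C p)| <= #|A|)%N.
    apply: subset_leq_card; rewrite !subUset !sub1set pA p'A subsetDl //.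
  by rewrite (card_nb L) !cardsU1 (card_nonnb L pA) in_setU1 negb_or eq_sym pp' p'C
    nonnb_notself k1.
move=> k2.
have : (0 < #|C p :\ a :\ q|)%N.
  have := cardsD1 a (C p); have := cardsD1 q (C p :\ a).
  rewrite (card_nonnb L pA) => e1 e2; move: k2; rewrite e2 e1; clear.
  by case: (_ \in _); case: (_ \in _); rewrite ?add0n ?add1n //; case: #|_|.
case/card_gt0P => c; rewrite !in_setD1 => /and3P[cq ca cC]; have cA := nonnb_sub cC.
have /eqP/cards1P[c' e''] := (common_card1 L pA cC).1.
have : c' \in C p :&: C c by rewrite e'' set11.
rewrite in_setI => /andP[c'C c'Cc]; have c'A := nonnb_sub c'C.
have only u : u \in C p -> p' \in C u -> u = a.
  move=> uC p'u; apply/set1P; rewrite -e in_setI uC nonnb_sym ?(nonnb_sub uC) //.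
case/or3P: (nonnb_cover L pA cC c'C c'Cc p'A) => [|/only|/only] h.
- by rewrite h in p'C.
- by rewrite h ?eqxx in ca.
- have c'a := h c'C; rewrite c'a in c'Cc.
  have : c \in C p :&: C a by rewrite in_setI cC nonnb_sym.
  by rewrite e' in_set1 (negPf cq).
Qed.

Lemma antipode_map : exists f : G -> G,
  [/\ forall p, p \in A -> f p \in B,
      forall b, b \in B -> exists2 p, p \in A & b = f p,
      {in A &, injective f},
      {in A &, forall p p', adj p (f p') = (p \in C p')} &
      {in A &, forall p p', adj (f p) (f p') = adj p p'}].
Proof.
pose f p := odflt p [pick b in B | nb b :&: A == C p].
have fP p : p \in A -> f p \in B /\ nb (f p) :&: A = C p.
  move=> pA; rewrite /f; case: pickP => [b /andP[bB /eqP]|no] //.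
  by have [b bB e] := antipode_exists L pA; have := no b; rewrite bB e eqxx.
have fB p : p \in A -> f p \in B by case/fP.
have fC p : p \in A -> nb (f p) :&: A = C p by case/fP.
have fi : {in A &, injective f}.
  move=> p p' pA p'A e; have eC : C p = C p' by rewrite -(fC p) // -(fC p') // e.
  have /card_gt0P[a aC] : (0 < #|C p|)%N by rewrite (card_nonnb L pA).
  have aA := nonnb_sub aC.
  have /eqP/cards1P[a' e'] := (common_card1 L pA aC).1.
  have : a' \in C p :&: C a by rewrite e' set11.
  rewrite in_setI => /andP[a'C a'Ca]; have a'A := nonnb_sub a'C.
  have /eqP/cards1P[r er] := (common_card1 L aA a'Ca).1.
  (* A point is determined by the set [C p]: it is the third point on the line through two collinear
     members [a], [a']. *)
  have mem1 q : q \in A -> C q = C p -> q = r.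
    move=> qA eq; apply/set1P; rewrite -er in_setI -!(nonnb_sym qA) // eq.
    by rewrite aC.
  by rewrite (mem1 p) // (mem1 p').
have imf : f @: A = B.
  apply/eqP; rewrite eqEcard (card_in_imset fi) !(card_nb L) leqnn andbT.
  by apply/subsetP => _ /imsetP[p pA ->]; apply: fB.
exists f; split=> //.
- by move=> b; rewrite -imf => /imsetP[p pA ->]; exists p.
- by move=> p p' pA p'A; rewrite -fC // in_setI pA andbT inE adj_sym.
have L' := antipodal_levels_sym L.
(* Seen from [y], [common_card1] gives [f p] and [f p'] one common neighbour in [A], that is, [C p]
   and [C p'] one common point; noncollinear points never have exactly one. *)
have sub p p' : p \in A -> p' \in A -> f p' \in nonnb y (f p) -> p' \in C p.
  move=> pA p'A h; have pp' : p != p'.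
    by apply: contraTneq h => ->; apply: nonnb_notself.
  apply: contraT => /(noncollinear_common pA p'A pp').
  have [_] := common_card1 L' (fB _ pA) h.
  suff -> : nb (f p) :&: A :&: nb (f p') = C p :&: C p' by move=> ->.
  rewrite -(fC p) // -(fC p') //; apply/setP => v; rewrite !in_setI.
  by case: (v \in A); rewrite ?andbF // !andbT.
move=> p p' pA p'A.
have [->|pp'] := eqVneq p p'; first by rewrite !adj_irr.
suff : (f p' \in nonnb y (f p)) = (p' \in C p).
  rewrite !nonnbE [adj y _](_ : _ = true); last by have := fB _ p'A; rewrite inE.
  rewrite [adj x _](_ : _ = true); last by move: p'A; rewrite inE.
  rewrite /= [p' == _]eq_sym pp' [f p' != _](_ : _ = true) /=;
    first by apply: (can_inj negbK).
  by apply: contra pp' => /eqP/fi -> //.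
(* [f] maps [T] bijectively onto the k + 1 elements of [nonnb y (f p)], so the inclusion of [T] in
   [C p] is an equality. *)
pose T := [set q in A | f q \in nonnb y (f p)].
have TC : T \subset C p by apply/subsetP => q; rewrite inE => /andP[qA]; apply: sub.
suff /eqP e : T == C p.
  by rewrite -e [RHS]in_set p'A.
rewrite eqEcard TC (card_nonnb L pA).
suff -> : #|T| = #|nonnb y (f p)| by rewrite (card_nonnb L' (fB _ pA)) /=.
have <- : f @: T = nonnb y (f p).
  apply/setP => b; apply/imsetP/idP => [[q] |h].
    by rewrite inE => /andP[_ h] ->.
  have : b \in f @: A by rewrite imf (nonnb_sub h).
  by case/imsetP => q qA e; exists q => //; rewrite inE qA -e.
apply/esym/card_in_imset => u v; rewrite !inE => /andP[uA _] /andP[vA _].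
by apply: fi; rewrite inE.
Qed.

End Antipodes.

(** * Generalized quadrangles with lines of size three *)

(* The collinearity graph of a generalized quadrangle GQ(2, (k - 1) / 2); the case
   k = 1 is a single line of three points. *)
Record quadrangle (P : finType) (c : rel P) (k : nat) : Prop := {
  qd_irr : irreflexive c;
  qd_sym : symmetric c;
  qd_card : #|P| = (3 * k)%N;
  qd_deg : forall a, #|[set b | c a b]| = k.+1;
  qd_third : forall a b, c a b ->
    exists t, [/\ c a t, c b t & forall u, c a u -> c b u -> u = t];
  qd_cover : forall a b t d, c a b -> c a t -> c b t -> [|| c d a, c d b | c d t] }.

(* Labels for the points of a quadrangle: [LA i], [LB i] form a double-s (with
   [LA i] collinear to [LB j] iff [i != j]), [LD i j] is the third point of the
   line through [LA i] and [LB j], and [LE] is the one point left over if s = 4. *)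
Inductive label := LA of nat | LB of nat | LD of nat & nat | LE.

Definition label_code u :=
  match u with
  | LA i => (0, i, 0) | LB i => (1, i, 0) | LD i j => (2, i, j) | LE => (3, 0, 0)
  end%N.

Definition label_decode (t : nat * nat * nat) :=
  match t with
  | (0, i, _) => LA i | (1, i, _) => LB i | (2, i, j) => LD i j | _ => LE
  end%N.

Lemma label_codeK : cancel label_code label_decode.
Proof. by case. Qed.

HB.instance Definition _ := Equality.copy label (can_type label_codeK).

Definition collinear (u v : label) : bool :=
  match u, v with
  | LA i, LB j | LB i, LA j => i != j
  | LA l, LD i j | LB l, LD i j | LD i j, LA l | LD i j, LB l => (l == i) || (l == j)
  | LD i j, LD l n => [&& i != l, i != n, j != l & j != n]
  | LD _ _, LE | LE, LD _ _ => true
  | _, _ => false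
  end.

(** [LD i j] is listed only for i < j, as it agrees with [LD j i]. For s = 3, 4, 6 this makes 9, 15
    and 27 points; s = 6 is the double-six among the 27 lines on a cubic surface. *)
Definition labels (s : nat) : seq label :=
  [seq LA i | i <- iota 0 s] ++ [seq LB i | i <- iota 0 s]
  ++ [seq LD i j | j <- iota 0 s, i <- iota 0 j] ++ nseq (s == 4%N) LE.

(** The quadrangle for k = 1 has no two noncollinear points to start from; three mutually collinear
    labels stand for its only line. *)
Definition line_labels : seq label := [:: LA 0; LB 1; LD 0 1].

Definition label_ok (s : nat) (u : label) : bool :=
  match u with
  | LA i | LB i => (i < s)%N
  | LD i j => (i < j < s)%N
  | LE => s == 4%N
  end.

(** Injectivity of [g] is not asked for: it follows from [separated_inj] when distinct labels differ
    in their collinearities. *)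
Definition labelled (P : finType) (c : rel P) (l : seq label) : Prop :=
  size l = #|P| /\ exists g, {in l &, forall u v, c (g u) (g v) = collinear u v}.

Section Quadrangle.
Variables (P : finType) (c : rel P) (k : nat).
Hypothesis Q : quadrangle c k.
Let cirr := qd_irr Q.
Let csym := qd_sym Q.

Definition third (a b : P) : P := odflt a [pick t | c a t && c b t].

Lemma thirdP a b : c a b -> c a (third a b) /\ c b (third a b).
Proof.
move=> ab; rewrite /third; case: pickP => [t /andP[]|no] //.
by have [t [at_ bt _]] := qd_third Q ab; have := no t; rewrite at_ bt.
Qed.

Lemma third_unique a b u : c a b -> c a u -> c b u -> u = third a b.
Proof.
move=> ab au bu; have [t [_ _ tu]] := qd_third Q ab.
by have [h1 h2] := thirdP ab; rewrite (tu _ au bu) (tu _ h1 h2).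
Qed.

Lemma third_sym a b : c a b -> third a b = third b a.
Proof.
move=> ab; have ba : c b a by rewrite csym.
by have [? ?] := thirdP ba; apply/esym/third_unique.
Qed.

(** The quadrangle axiom in two halves: a point off a line is collinear to at least one of its three
    points, and by [third_out] and [third_outr] to at most one. *)
Lemma third_fill a b d : c a b -> ~~ c d a -> ~~ c d b -> c d (third a b).
Proof.
move=> ab /negPf da /negPf db; have [h1 h2] := thirdP ab.
by have := qd_cover Q d ab h1 h2; rewrite da db.
Qed.

Lemma third_out a b d : c a b -> c d a -> d != b -> ~~ c d (third a b).
Proof.
move=> ab da; have [h1 h2] := thirdP ab.
apply: contra => dt; apply/eqP.
have -> : b = third a (third a b) by apply: third_unique => //; rewrite csym.
by apply: third_unique => //; rewrite csym.
Qed.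

Lemma third_outr a b d : c a b -> c d b -> d != a -> ~~ c d (third a b).
Proof. by move=> ab db da; rewrite third_sym // third_out // csym. Qed.

(** * Double-s configurations in a quadrangle *)

Section DoubleSix.
Variables (s : nat) (a b : nat -> P).
Hypothesis ab : forall i j, (i < s)%N -> (j < s)%N -> c (a i) (b j) = (i != j).
Hypothesis aa : forall i j, (i < s)%N -> (j < s)%N -> c (a i) (a j) = false.
Hypothesis bb : forall i j, (i < s)%N -> (j < s)%N -> c (b i) (b j) = false.

Let d i j := third (a i) (b j).
Let ba i j : (i < s)%N -> (j < s)%N -> c (b i) (a j) = (i != j).
Proof. by move=> hi hj; rewrite csym ab // eq_sym. Qed.

Let dij i j : (i < s)%N -> (j < s)%N -> i != j -> c (a i) (b j).
Proof. by move=> hi hj ij; rewrite ab. Qed.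

Let a_inj i j : (i < s)%N -> (j < s)%N -> i != j -> a i != a j.
Proof. by move=> hi hj ij; apply: contraTneq (dij hi hj ij) => ->;
  rewrite ab // eqxx. Qed.

Let b_inj i j : (i < s)%N -> (j < s)%N -> i != j -> b i != b j.
Proof. by move=> hi hj ij; apply: contraTneq (dij hi hj ij) => <-;
  rewrite ab // eqxx. Qed.

(** [a j] is collinear to neither [a i] nor [b j], hence to [d i j], and so is [b i]; thus [d i j]
    also completes the line through [a j] and [b i]. *)
Lemma double_third_sym i j : (i < s)%N -> (j < s)%N -> i != j -> d i j = d j i.
Proof.
move=> hi hj ij; have h := dij hi hj ij.
apply: third_unique; first by rewrite ab // eq_sym.
  by apply: third_fill => //; rewrite ?aa // ab // eqxx.
by apply: third_fill => //; rewrite ?bb // ba // eqxx.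
Qed.

Lemma double_A_third l i j : (l < s)%N -> (i < s)%N -> (j < s)%N -> i != j ->
  c (a l) (d i j) = (l == i) || (l == j).
Proof.
move=> hl hi hj ij; have h := dij hi hj ij.
have [->|li] := eqVneq l i; first by have [] := thirdP h.
have [->|lj] := eqVneq l j; first by apply: third_fill => //; rewrite ?aa // ab // eqxx.
by apply/negbTE/third_outr; rewrite // ?ab // a_inj.
Qed.

Lemma double_B_third l i j : (l < s)%N -> (i < s)%N -> (j < s)%N -> i != j ->
  c (b l) (d i j) = (l == i) || (l == j).
Proof.
move=> hl hi hj ij; have h := dij hi hj ij.
have [->|lj] := eqVneq l j; first by rewrite orbT; have [] := thirdP h.
have [->|li] := eqVneq l i; first by apply: third_fill => //; rewrite ?bb // ba // eqxx.
by apply/negbTE/third_out; rewrite // ?ba // b_inj.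
Qed.

Let dd_share i j n : (i < s)%N -> (j < s)%N -> (n < s)%N -> i != j -> i != n ->
  c (d i j) (d i n) = false.
Proof.
move=> hi hj hn ij in_; have [->|jn] := eqVneq j n; first exact: cirr.
apply/negbTE; rewrite csym; apply: third_out; first exact: dij.
  by rewrite csym double_A_third // eqxx.
apply/eqP => e; have := double_B_third hn hi hn in_.
by rewrite e bb // eqxx orbT.
Qed.

Lemma double_third_third i j l n : (i < s)%N -> (j < s)%N -> (l < s)%N -> (n < s)%N ->
  i != j -> l != n -> c (d i j) (d l n) = [&& i != l, i != n, j != l & j != n].
Proof.
move=> hi hj hl hn ij ln.
have [e|il] := eqVneq i l; first by subst l; rewrite dd_share.
have [e|in_] := eqVneq i n; first by subst n;
  rewrite (double_third_sym hl) ?dd_share // eq_sym.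
have [e|jl] := eqVneq j l.
  by subst l; rewrite double_third_sym // dd_share // eq_sym.
have [e|jn] := eqVneq j n.
  by subst n; rewrite double_third_sym // (double_third_sym hl) // dd_share // eq_sym.
rewrite csym; apply: third_fill; first exact: dij.
  by rewrite csym double_A_third // negb_or il.
by rewrite csym double_B_third // negb_or jl.
Qed.

Section Residual.
Variables i j l n : nat.
Hypotheses (hi : (i < s)%N) (hj : (j < s)%N) (hl : (l < s)%N) (hn : (n < s)%N).
Hypothesis ijln : uniq [:: i; j; l; n].
Let w := third (d i j) (d l n).

Let ij : i != j. Proof. by move: ijln; rewrite /= !inE !negb_or;
  case/andP=> /andP[]. Qed.
Let ln : l != n. Proof. by move: ijln; rewrite /= !inE !negb_or; case/and4P. Qed.
Let dd : c (d i j) (d l n).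
Proof.
rewrite double_third_third //; move: ijln; rewrite /= !inE !negb_or.
by case/and4P => /and3P[_ -> ->] /andP[-> ->].
Qed.

(** On the line of [d i j], [d l n] and [w], the point [a t] is collinear to one of the first two
    precisely when [t] is among the four indices, and to [w] otherwise. *)
Lemma double_A_residual t : (t < s)%N -> c (a t) w = (t \notin [:: i; j; l; n]).
Proof.
move=> ht; case: (boolP (c (a t) (d i j))) => h1.
  rewrite (negPf (third_out dd h1 _)); last first.
    apply/eqP => e; move: h1; rewrite double_A_third // => h1.
    have := double_A_third hl hl hn ln; rewrite -e eqxx aa //.
  by move: h1; rewrite double_A_third // !inE orbA => ->.
case: (boolP (c (a t) (d l n))) => h2.
  rewrite (negPf (third_outr dd h2 _)); last first.
    apply/eqP => e; have := double_A_third hi hi hj ij; rewrite -e eqxx aa //.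
  by move: h2; rewrite double_A_third // !inE orbA => ->; rewrite orbT.
rewrite third_fill //; move: h1 h2; rewrite !double_A_third // !inE !negb_or.
by case/andP => -> -> /andP[-> ->].
Qed.

Lemma double_B_residual t : (t < s)%N -> c (b t) w = (t \notin [:: i; j; l; n]).
Proof.
move=> ht; case: (boolP (c (b t) (d i j))) => h1.
  rewrite (negPf (third_out dd h1 _)); last first.
    by apply/eqP => e; have := double_B_third hl hl hn ln; rewrite -e eqxx bb.
  by move: h1; rewrite double_B_third // !inE orbA => ->.
case: (boolP (c (b t) (d l n))) => h2.
  rewrite (negPf (third_outr dd h2 _)); last first.
    by apply/eqP => e; have := double_B_third hi hi hj ij; rewrite -e eqxx bb.
  by move: h2; rewrite double_B_third // !inE orbA => ->; rewrite orbT.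
rewrite third_fill //; move: h1 h2; rewrite !double_B_third // !inE !negb_or.
by case/andP => -> -> /andP[-> ->].
Qed.

End Residual.

Hypothesis a0_nbr : forall v, c (a 0) v -> exists2 i, (0 < i < s)%N & v = b i \/ v
  = d 0 i.

(* For s > 4 the third point [w] of the line through [d 1 2] and [d 3 4] is
   collinear to [a 0], hence is some [d 0 i], which leaves only the index i = 5. *)
Lemma double_size : (4 < s)%N -> s = 6%N.
Proof.
move=> s5; have hs t : (t <= 4)%N -> (t < s)%N by move=> ht; apply: leq_ltn_trans s5.
pose w := third (d 1 2) (d 3 4).
have wA t : (t < s)%N -> c (a t) w = (t \notin [:: 1; 2; 3; 4]%N).
  by apply: double_A_residual; rewrite ?hs.
have := wA 0%N (hs 0%N isT) => /a0_nbr[i /andP[i0 hi] [e|e]].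
  have := wA 1%N (hs 1%N isT); have := wA 2%N (hs 2%N isT).
  by rewrite e !(ab _ hi) ?hs // => /eqP <-.
have wd t : (t < s)%N -> (t \notin [:: 1; 2; 3; 4]%N) = (t == 0%N) || (t == i).
  by move=> ht; rewrite -wA // e (double_A_third ht (hs 0%N isT) hi) // eq_sym -lt0n.
have i5 : (4 < i)%N.
  by have := wd i hi; rewrite eqxx orbT !inE; case: i i0 {hi e wd} => [|[|[|[|[]]]]].
have s6 : (5 < s)%N by apply: leq_ltn_trans hi.
have := wd 5%N s6; rewrite /= => /esym/eqP i5e; subst i.
apply/eqP; rewrite eqn_leq s6 andbT leqNgt; apply/negP => s7.
by have := wd 6%N s7.
Qed.

End DoubleSix.
End Quadrangle.

(** * Classification of the quadrangles *)

Section Classification.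
Variables (P : finType) (c : rel P) (k : nat).
Hypothesis Q : quadrangle c k.
Let cirr := qd_irr Q.
Let csym := qd_sym Q.
Local Notation third := (third c).

(** One half of the double-s grown from noncollinear [p], [q] with common collinear points [e];
    exchanging [p] and [q] gives the other half. *)
Definition spoke (p q : P) (e : seq P) (i : nat) : P :=
  if i is i'.+1 then third p (nth p e i') else q.

Section Spokes.
Variables (p q : P) (e : seq P).
Hypothesis pq : p != q.
Hypotheses (eu : uniq e) (mem_e : forall v, (v \in e) = c p v && c q v).
Local Notation s := (size e).+1.
Local Notation cc i := (nth p e i).

Lemma spoke_collinear i : (i < size e)%N -> c p (cc i) /\ c q (cc i).
Proof. by move=> hi; apply/andP; rewrite -mem_e mem_nth. Qed.

Lemma spoke_third_off i : (i < size e)%N -> c q (third p (cc i)) = false.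
Proof.
move=> hi; have [h1 h2] := spoke_collinear hi.
by apply/negbTE; rewrite (third_outr Q) // eq_sym.
Qed.

Lemma spoke_center i j : (i < size e)%N -> (j < size e)%N ->
  c (cc j) (third p (cc i)) = (i == j).
Proof.
move=> hi hj; have [h1 h2] := spoke_collinear hi; have [h3 h4] := spoke_collinear hj.
have [->|ij] := eqVneq i j; first by have [] := thirdP Q h3.
by apply/negbTE; apply: (third_out Q); rewrite // 1?csym // nth_uniq // eq_sym.
Qed.

Lemma spoke_nonadj i j : (i < s)%N -> (j < s)%N ->
  c (spoke p q e i) (spoke p q e j) = false.
Proof.
case: i j => [|i] [|j] //= hi hj; first exact: spoke_third_off.
  by rewrite csym spoke_third_off.
have [->|ij] := eqVneq i j; first exact: cirr.
have [h1 h2] := spoke_collinear hi; have [h3 h4] := spoke_collinear hj.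
apply/negbTE; apply: (third_out Q); rewrite // 1?csym; first by have [] := thirdP Q h1.
by apply/eqP => h; move: h4; rewrite -h spoke_third_off.
Qed.

End Spokes.

Variables (p q : P).
Hypotheses (pq : p != q) (npq : c p q = false).
Let e := enum [pred v | c p v && c q v].
Local Notation s := (size e).+1.
Local Notation a := (spoke p q e).
Local Notation b := (spoke q p e).

Let qp : q != p. Proof. by rewrite eq_sym. Qed.
Let nqp : c q p = false. Proof. by rewrite csym. Qed.
Let eu : uniq e. Proof. exact: enum_uniq. Qed.
Let mem_e v : (v \in e) = c p v && c q v. Proof. by rewrite mem_enum. Qed.
Let mem_e' v : (v \in e) = c q v && c p v. Proof. by rewrite mem_e andbC. Qed.

Lemma spokes_double i j : (i < s)%N -> (j < s)%N -> c (a i) (b j) = (i != j).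
Proof.
case: i j => [|i] [|j] //= hi hj.
- by have [h1 h2] := spoke_collinear mem_e hj; rewrite (set_nth_default p) //;
  have [] := thirdP Q h2.
- by have [h1 h2] := spoke_collinear mem_e hi; rewrite csym; have [] := thirdP Q h1.
have [h1 h2] := spoke_collinear mem_e hi; have [h3 h4] := spoke_collinear mem_e hj.
rewrite eqSS (set_nth_default p) //.
have ha : c q (third p (nth p e i)) = false by exact: (spoke_third_off pq mem_e).
have [ij|ij] := eqVneq i j.
  subst j; apply/negbTE; apply: (third_outr Q) => //; first by rewrite csym;
    have [] := thirdP Q h1.
  apply/eqP => h; have := (thirdP Q h1).1; by rewrite h npq.
apply: (third_fill Q) => //; first by rewrite csym ha.
by rewrite csym (spoke_center eu mem_e) // (negPf ij).
Qed.

(** Here [a 0] is [q]. On the line through [q] and [v], either [v] or the third point is collinear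
    to [p], hence in [e]. *)
Lemma spoke_nbr v : c (a 0) v ->
  exists2 i, (0 < i < s)%N & v = b i \/ v = third (a 0) (b i).
Proof.
move=> /= qv; case: (boolP (c p v)) => pv.
  have ve : v \in e by rewrite mem_e pv.
  exists (index v e).+1; first by rewrite /= ltnS index_mem.
  right; rewrite /= nth_index //; have [h1 h2] := thirdP Q qv.
  by apply: (third_unique Q) => //; rewrite csym.
have [h1 h2] := thirdP Q qv.
have te : third q v \in e by rewrite mem_e h1 andbT (third_fill Q) ?npq.
exists (index (third q v) e).+1; first by rewrite /= ltnS index_mem.
by left; rewrite /= nth_index //; apply: (third_unique Q) => //; rewrite csym.
Qed.

(** Each line through [q] has exactly one point collinear to [p], so the points collinear to [q] are
    those of [e] and their images under [third q]. *)
Lemma spoke_count : (k.+1 = 2 * size e)%N.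
Proof.
rewrite -(qd_deg Q q).
have th v : v \in e -> third q (third q v) = v.
  rewrite mem_e => /andP[_ qv]; have [h1 h2] := thirdP Q qv.
  by apply/esym; apply: (third_unique Q) => //; rewrite csym.
have u2 : uniq (e ++ map (third q) e).
  rewrite cat_uniq eu /= map_inj_in_uniq ?eu ?andbT; last first.
    by move=> u v ue ve h; rewrite -(th u) // h th.
  apply/hasPn => _ /mapP[v + ->]; rewrite mem_e => /andP[pv qv].
  by rewrite mem_e negb_and (third_outr Q).
rewrite mul2n -addnn -{2}(size_map (third q) e) -size_cat -(card_uniqP u2).
apply: eq_card => v; rewrite inE mem_cat.
apply/idP/orP => [qv|[|/mapP[u + ->]]].
- have [i /andP[i0 hi]] := spoke_nbr qv; case: i i0 hi => // i _ hi.
  case=> ->; [right|left]; rewrite /=; first by rewrite map_f // mem_nth.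
  by rewrite th ?mem_nth.
- by rewrite mem_e => /andP[].
- by rewrite mem_e => /andP[_ qu]; have [] := thirdP Q qu.
Qed.

Lemma labels_ok n : n \in [:: 3; 4; 6]%N -> all (label_ok n) (labels n).
Proof. by rewrite !inE => /or3P[] /eqP ->. Qed.

Lemma classification_noncollinear :
  exists2 n, n \in [:: 3; 4; 6]%N & k = (2 * n - 3)%N /\ labelled c (labels n).
Proof.
have ab := spokes_double.
have aa := spoke_nonadj pq mem_e.
have bb := spoke_nonadj qp mem_e'.
have ks : k = (2 * s - 3)%N by have := spoke_count; lia.
(* A single common point would give k = 1, so only three points; but [p], [q], that point and the
   third one on its line with [p] are distinct. *)
have s3 : (2 < s)%N.
  rewrite ltnS ltnNge; apply/negP => le1.
  have k1 : k = 1%N by have := qd_deg Q p; have := spoke_count; lia.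
  have e1 : (0 < size e)%N by have := spoke_count; rewrite k1; lia.
  have [h1 h2] := spoke_collinear mem_e e1; have [h3 h4] := thirdP Q h1.
  have : (#|[set p; q; nth p e 0; third p (nth p e 0)]| <= #|P|)%N by apply: max_card.
  rewrite (qd_card Q) k1 -!setUA !cardsU1 cards1 !inE !negb_or.
  have ne u v : c u v -> u != v by apply: contraTneq => ->; rewrite cirr.
  have qa : q != third p (nth p e 0) by apply: contraTneq h3 => <-; rewrite npq.
  by rewrite pq (ne _ _ h1) (ne _ _ h3) (ne _ _ h2) qa (ne _ _ h4).
have s346 : s \in [:: 3; 4; 6]%N.
  rewrite !inE; case: (ltnP 4 s) => h; last by move: s3 h; case: (s) => [|[|[|[|[]]]]].
  by rewrite (double_size Q ab aa bb spoke_nbr h).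
exists s => //; split => //; split.
  rewrite (qd_card Q) ks; move: s346; rewrite !inE; by case/or3P => /eqP ->.
pose d i j := third (a i) (b j).
pose w := third (d 0 1) (d 2 3).
pose g u := match u with LA i => a i | LB i => b i | LD i j => d i j | LE => w end.
have labs := labels_ok s346.
exists g => u v /(allP labs) hu /(allP labs) hv.
have lts i j : (i < j < s)%N -> [/\ (i < s)%N, (j < s)%N & i != j].
  by case/andP=> ij js; split=> //; [exact: ltn_trans ij js | rewrite neq_ltn ij].
have AD := double_A_third Q ab aa; have BD := double_B_third Q ab bb.
have DD := double_third_third Q ab aa bb.
have WA r : s == 4%N -> (r < s)%N -> c (a r) w = false.
  move=> /eqP s4 ht; rewrite (double_A_residual Q ab aa bb) ?s4 //; last by rewrite -s4.
  by move: ht; rewrite s4; case: r => [|[|[|[|]]]].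
have WB r : s == 4%N -> (r < s)%N -> c (b r) w = false.
  move=> /eqP s4 ht; rewrite (double_B_residual Q ab aa bb) ?s4 //; last by rewrite -s4.
  by move: ht; rewrite s4; case: r => [|[|[|[|]]]].
(* [d 0 1], [d 2 3] and [w] form a line; every other [d i j] shares an index with both of the first
   two, so it is collinear to [w]. *)
have WD i j : s == 4%N -> (i < j < s)%N -> c (d i j) w = true.
  move=> /eqP s4 /[dup] hij /lts[hi hj ij].
  have dd : c (d 0 1) (d 2 3) by rewrite DD ?s4.
  have [h1 h2] := thirdP Q dd.
  have : (i, j) \in [:: (0, 1); (0, 2); (0, 3); (1, 2); (1, 3); (2, 3)]%N.
    by move: hij; rewrite s4 => /andP[]; clear; case: i j => [|[|[|i]]] [|[|[|[|j]]]].
  rewrite !inE; do ?case/orP; case/eqP => ? ?; subst i j => //;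
    by apply: (third_fill Q) => //; rewrite DD // s4.
case: u v hu hv => [i|i|i j|] [l|l|l n|] /= hu hv; rewrite ?cirr //;
  rewrite ?aa ?bb ?ab //; try (have [? ? ?] := lts _ _ hu);
  try (have [? ? ?] := lts _ _ hv); rewrite ?AD ?BD ?DD ?WA ?WB ?WD //;
  by rewrite csym ?AD ?BD ?WA ?WB ?WD // ab // eq_sym.
Qed.

End Classification.

(** The half of k + 3 inverts k = 2s - 3. *)
Definition quadrangle_labels (k : nat) : seq label :=
  if k == 1%N then line_labels else labels (k + 3)./2.

Lemma quadrangle_classification (P : finType) (c : rel P) k :
  quadrangle c k -> (0 < k)%N ->
  k \in [:: 1; 3; 5; 9]%N /\ labelled c (quadrangle_labels k).
Proof.
move=> Q k0.
case: (pickP [pred u : P * P | (u.1 != u.2) && ~~ c u.1 u.2]) => [[p q] /andP[/= pq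
  npq]|all_c].
  have [n + [kn lab]] := classification_noncollinear Q pq (negbTE npq).
  by rewrite !inE kn => /or3P[] /eqP n_; subst n; split.
have {}all_c p q : p != q -> c p q.
  by move=> pq; have := all_c (p, q); rewrite /= pq => /negbFE.
have /card_gt0P[p _] : (0 < #|P|)%N by rewrite (qd_card Q); lia.
(* All 3k - 1 other points are collinear to [p], and these number k + 1. *)
have k1 : k = 1%N.
  have := cardsC1 p; rewrite (qd_card Q).
  suff -> : [set~ p] = [set q | c p q] by rewrite (qd_deg Q); lia.
  apply/setP => q; rewrite !inE; apply/idP/idP => [|pq];
    first by rewrite eq_sym => /all_c.
  by apply: contraTneq pq => ->; rewrite (qd_irr Q).
have /card_gt0P[q] : (0 < #|[set q | c p q]|)%N by rewrite (qd_deg Q).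
rewrite inE => pq; have [h1 h2] := thirdP Q pq.
rewrite k1; split => //; split; first by rewrite (qd_card Q) k1.
exists (fun u => match u with LA _ => p | LB _ => q | _ => third c p q end) => u v.
by rewrite !inE => /or3P[]/eqP-> /or3P[]/eqP-> /=; rewrite ?(qd_irr Q) // (qd_sym Q).
Qed.

(** * Antipodal doubles *)

(* A vertex of the antipodal double of a quadrangle is a sign together with a
   point of the quadrangle or [None]; changing the sign gives the antipode. *)
Definition vlabel := (bool * option label)%type.

Definition vcollinear (u v : option label) : bool :=
  match u, v with Some a, Some b => collinear a b | _, _ => false end.

Lemma collinear_sym : symmetric collinear.
Proof.
by move=> [i|i|i j|] [l|l|l n|] //=; rewrite 1?eq_sym // ![l == _]eq_sym ![n ==
  _]eq_sym;
  do 4!case: eqP.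
Qed.

(** [None] with its two signs stands for [x] and [y]. Crossing from one sign to the other replaces
    noncollinearity by collinearity, as in [antipode_map]. *)
Definition vadj (u v : vlabel) : bool :=
  (u.2 != v.2) && ((u.1 == v.1) (+) vcollinear u.2 v.2).

Definition vlabels (l : seq label) : seq vlabel :=
  [seq (s, u) | s <- [:: true; false], u <- None :: map Some l].

Definition coded (G : sgraph) (l : seq label) : Prop :=
  #|G| = size (vlabels l) /\
  exists F : vlabel -> G, {in vlabels l &, forall u v, adj (F u) (F v) = vadj u v}.

(** A computable condition under which every map preserving and reflecting the relation on [V] is
    injective. *)
Definition separated (T : eqType) (r : rel T) (V : seq T) : bool :=
  all (fun u => all (fun v => (u == v) || has (fun w => r u w != r v w) V) V) V.

Lemma separated_inj (T : eqType) (U : Type) (r : rel T) (r' : U -> U -> bool)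
    V (F : T -> U) :
  separated r V -> {in V &, forall u v, r' (F u) (F v) = r u v} -> {in V &,
    injective F}.
Proof.
move=> sV FV u v uV vV e; have /allP/(_ v vV) := allP sV u uV.
by case/predU1P => // /hasP[w wV]; rewrite -!FV // e eqxx.
Qed.

(** * Transfer between a coded graph and its list of codes *)

Section Coding.
Variables (G : sgraph) (V : seq vlabel) (F : vlabel -> G).
Hypothesis lsep : separated vadj V.
Hypothesis Vuniq : uniq V.
Hypothesis cG : #|G| = size V.
Hypothesis FV : {in V &, forall u v, adj (F u) (F v) = vadj u v}.

Lemma coding_inj : {in V &, injective F}.
Proof. exact: separated_inj lsep FV. Qed.

Lemma coding_surj x : exists2 u, u \in V & x = F u.
Proof.
suff : x \in map F V by move/mapP.
have uF : uniq (map F V) by rewrite map_inj_in_uniq //; apply: coding_inj.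
have /subset_cardP h : #|map F V| = #|[set: G]|.
  by rewrite (card_uniqP uF) size_map cardsT cG.
have /h -> : map F V \subset [set: G] by apply/subsetP => z; rewrite inE.
by rewrite inE.
Qed.

(** Turns cardinalities in the graph into counts over a list, which computation can settle. *)
Lemma coding_card (S : {set G}) : #|S| = count (fun u => F u \in S) V.
Proof.
rewrite -size_filter -(size_map F).
have uF : uniq (map F [seq u <- V | F u \in S]).
  rewrite map_inj_in_uniq ?filter_uniq // => u v; rewrite !mem_filter.
  by case/andP=> _ uV /andP[_ vV]; apply: coding_inj.
rewrite -(card_uniqP uF); apply: eq_card => x.
apply/idP/mapP => [px|[u + ->]]; last by rewrite mem_filter => /andP[].
by have [u uV e] := coding_surj x; exists u; rewrite // mem_filter /= -e px.
Qed.

End Coding.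

Lemma coded_isomorphic (G H : sgraph) l : separated vadj (vlabels l) -> uniq
  (vlabels l) ->
  coded G l -> coded H l -> isomorphic G H.
Proof.
move=> lsep Vu [cG [F FV]] [cH [F' FV']].
have inG := coding_inj lsep FV; have inH := coding_inj lsep FV'.
pose V := vlabels l; pose u0 : vlabel := (true, None).
pose f x := F' (nth u0 V (index x (map F V))).
have fF u : u \in V -> f (F u) = F' u.
  move=> uV; rewrite /f; congr F'.
  have uF : uniq (map F V) by rewrite map_inj_in_uniq.
  by rewrite -{1}(nth_index u0 uV) -(nth_map _ (F u0)) ?index_mem // index_uniq
    ?size_map ?index_mem // nth_index.
have surjG := coding_surj lsep Vu cG FV.
exists f; split; last first.
  by move=> x y; have [u uV ->] := surjG x; have [v vV ->] := surjG y;
    rewrite !fF // FV' // FV.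
apply: inj_card_bij; last by rewrite cG cH.
move=> x y; have [u uV ->] := surjG x; have [v vV ->] := surjG y.
by rewrite !fF // => /inH ->.
Qed.

Lemma isomorphic_coded (G H : sgraph) l : isomorphic G H -> coded H l -> coded G l.
Proof.
case=> f [bf fadj] [cH [F FV]]; split; first by rewrite -cH (bij_eq_card bf).
have [g fK gK] := bf; exists (g \o F) => u v uV vV /=.
by rewrite -fadj !gK FV.
Qed.

Lemma quadrangle_labels_separated k : k \in [:: 1; 3; 5; 9]%N ->
  separated collinear (quadrangle_labels k).
Proof. by rewrite !inE => /or4P[] /eqP ->; vm_compute. Qed.

(** * From the distance levels to the antipodal double *)

Section CodeLevels.
Variables (G : sgraph) (k : nat) (x y : G).
Hypothesis L : antipodal_levels k x y.
Local Notation A := (nb x).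
Local Notation B := (nb y).
Local Notation C := (nonnb x).
Let Gc := al_conn L.

Let P := {v : G | v \in A}.
Let c : rel P := fun u v => val v \in C (val u).

Lemma levels_quadrangle : quadrangle c k.
Proof.
have cardP (S : {set G}) : S \subset A -> #|[set u : P | val u \in S]| = #|S|.
  move=> SA; rewrite -(card_imset _ val_inj); apply: eq_card => v.
  apply/imsetP/idP => [[u + ->]|vS]; first by rewrite inE.
  by exists (Sub v (subsetP SA v vS)); rewrite ?inE SubK.
split.
- by move=> u; apply/negbTE/nonnb_notself.
- by move=> u v; rewrite /c nonnb_sym ?(valP u) ?(valP v).
- by rewrite card_sig -(card_nb L x); apply: eq_card => v; rewrite !inE.
- by move=> u; rewrite (cardP (C (val u))) ?subsetDl // (card_nonnb L (valP u)).
- move=> a b ab; have /eqP/cards1P[t e] := (common_card1 L (valP a) ab).1.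
  have : t \in C (val a) :&: C (val b) by rewrite e set11.
  rewrite in_setI => /andP[at_ bt]; exists (Sub t (nonnb_sub at_)).
  rewrite /c SubK; split=> // u au bu; apply: val_inj; apply/set1P.
  by rewrite SubK -e in_setI au.
move=> a b t d ab at_ bt.
have := nonnb_cover L (valP a) ab at_ bt (valP d).
by rewrite /c !(nonnb_sym (valP d)) ?(valP a) ?(valP b) ?(valP t).
Qed.

Lemma card_levels : #|G| = (2 * (3 * k).+1)%N.
Proof.
rewrite -cardsT.
have -> : [set: G] = B1 x :|: B1 y.
  apply/setP => v; rewrite !inE -!(dist_eq1 Gc) -!(dist_eq0 Gc) !(dist_sym Gc v).
  by have := al_dist L v; lia.
rewrite cardsU !(cardB1 L); have -> : B1 x :&: B1 y = set0.
  apply/setP => v; rewrite !inE -!(dist_eq1 Gc) -!(dist_eq0 Gc) !(dist_sym Gc v).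
  by have := al_dist L v; lia.
by rewrite cards0; lia.
Qed.

Lemma levels_coded : (0 < k)%N -> k \in [:: 1; 3; 5;
  9]%N /\ coded G (quadrangle_labels k).
Proof.
move=> k0; have [k4 [sl [g gl]]] := quadrangle_classification levels_quadrangle k0.
split => //; set l := quadrangle_labels k in sl gl *.
have sP : #|{: P}| = (3 * k)%N by rewrite (qd_card levels_quadrangle).
split; first by rewrite card_levels size_allpairs /= size_map sl sP.
have [f [fB _ _ fadjl fadjr]] := antipode_map L.
(* The sign [true] is the side of [x]; [f] carries it to the side of [y]. *)
exists (fun u => match u with
  | (true, None) => x | (false, None) => y
  | (true, Some a) => val (g a) | (false, Some a) => f (val (g a)) end).
have xA a : adj x (val (g a)) by have := valP (g a); rewrite inE.
have yB a : adj y (f (val (g a))) by have := fB _ (valP (g a)); rewrite inE.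
have yA v : adj x v -> adj y v = false.
  by rewrite -!(dist_eq1 Gc); have := al_dist L v; lia.
have xy : adj x y = false.
  by rewrite -(dist_eq1 Gc); have := al_dist L y; rewrite dist_xx; lia.
have xB v : adj y v -> adj x v = false.
  by rewrite -!(dist_eq1 Gc); have := al_dist L v; lia.
have gC a b : a \in l -> b \in l -> (val (g b) \in C (val (g a))) = collinear a b.
  by move=> al bl; rewrite -gl.
have lirr a : a \in l -> collinear a a = false.
  by move=> al; rewrite -gC //; apply/negbTE/nonnb_notself.
have gi : {in l &, injective g} by apply: separated_inj gl;
  apply: quadrangle_labels_separated.
have gadj a b : a \in l -> b \in l -> adj (val (g a)) (val (g b)) = (a != b) && ~~
  collinear a b.
  move=> al bl; have [->|ab] := eqVneq a b; first by rewrite adj_irr.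
  rewrite -gC // nonnbE xA /= negb_and !negbK.
  by case: eqVneq => // /val_inj/gi e; rewrite e ?eqxx in ab.
have fadj a b : a \in l -> b \in l -> adj (val (g a)) (f (val (g b))) = collinear a b.
  by move=> al bl; rewrite fadjl ?(valP (g _)) // -gC // nonnb_sym ?(valP (g _)).
move=> [s u] [t v] /allpairsP[[s1 u1] /= [_ h [-> ->]]] /allpairsP[[t1 v1] /= [_ h'
  [-> ->]]].
clear s u t v; move: h h'.
case: u1 => [a|]; case: v1 => [b|]; rewrite !inE ?(mem_map Some_inj) //= => al bl;
  case: s1; case: t1; rewrite /vadj /= ?adj_irr ?xA ?yB ?xy //=.
- exact: gadj.
- rewrite fadj // (inj_eq Some_inj).
  by case: (eqVneq a b) => // ->; rewrite lirr.
- rewrite adj_sym fadj // (inj_eq Some_inj) collinear_sym.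
  by case: (eqVneq a b) => // ->; rewrite lirr.
- by rewrite fadjr ?(valP (g _)) // gadj.
- by rewrite adj_sym xA.
- by rewrite adj_sym yA ?xA.
- by rewrite adj_sym xB ?yB.
- by rewrite adj_sym yB.
- by rewrite xB ?yB.
- by rewrite yA ?xA.
- by rewrite adj_sym xy.
Qed.

End CodeLevels.

(** * Sharpness of the antipodal doubles *)

(** The properties from which sharpness is derived, each a finite check on codes. [bar] is the
    antipodal map, and [ty_third] is the unique third point on a line in the quadrangle at [u]. *)
Record taylor (G : sgraph) (k : nat) (bar : G -> G) : Prop := {
  ty_bar : forall u v, adj u (bar v) = [&& u != v, u != bar v & ~~ adj u v];
  ty_barK : involutive bar;
  ty_reg : regular G (3 * k)%N;
  ty_deg : forall u v : G, adj u v -> #|nonnb u v| = k.+1;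
  ty_third : forall u v w : G, adj u v -> w \in nonnb u v ->
    #|nonnb u v :&: nonnb u w| = 1%N }.

Definition vnon (u v w : vlabel) : bool := [&& vadj u w, w != v & ~~ vadj v w].

Definition taylor_check (V : seq vlabel) (k : nat) : bool :=
  all (fun u => (count (vadj u) V == 3 * k)%N && all (fun v => vadj u v ==>
    let N := filter (vnon u v) V in
    (size N == k.+1) && all (fun w => count (vnon u w) N == 1)%N N) V) V.

Lemma quadrangle_taylor_check k : k \in [:: 1; 3; 5; 9]%N ->
  taylor_check (vlabels (quadrangle_labels k)) k.
Proof. by rewrite !inE => /or4P[] /eqP ->; vm_compute. Qed.

Lemma quadrangle_vlabels_ok k : k \in [:: 1; 3; 5; 9]%N ->
  let V := vlabels (quadrangle_labels k) in uniq V && separated vadj V.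
Proof. by rewrite !inE => /or4P[] /eqP ->; vm_compute. Qed.

Lemma vadj_bar u v : let bar w := (~~ w.1, w.2) in
  vadj u (bar v) = [&& u != v, u != bar v & ~~ vadj u v].
Proof.
case: u v => [s u] [t v]; rewrite /= /vadj /= !xpair_eqE.
by case: (eqVneq u v); rewrite ?andbF ?andbT //=; case: s; case: t; case: vcollinear.
Qed.

Lemma vlabels_bar l u : u \in vlabels l -> (~~ u.1, u.2) \in vlabels l.
Proof.
case/allpairsP=> [[s a] /= [_ h ->]] /=; apply/allpairsP; exists (~~ s, a).
by split=> //=; case: s.
Qed.

Lemma coding_taylor (G : sgraph) k (V : seq vlabel) (F : vlabel -> G) :
  separated vadj V -> uniq V -> #|G| = size V ->
  {in V &, forall u v, adj (F u) (F v) = vadj u v} -> taylor_check V k ->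
  (forall u, u \in V -> (~~ u.1, u.2) \in V) -> exists bar : G -> G, taylor k bar.
Proof.
move=> Vs Vu cG FV /allP chk; pose vbar (w : vlabel) : vlabel := (~~ w.1, w.2).
rewrite -/vbar => vbarV.
have Fi := coding_inj Vs FV; have Fs := coding_surj Vs Vu cG FV.
have Fc S := coding_card Vs Vu cG FV S.
pose code x := nth (true, None) V (index x (map F V)).
have codeF u : u \in V -> code (F u) = u.
  move=> uV; rewrite /code; have uF : uniq (map F V) by rewrite map_inj_in_uniq.
  by rewrite -{1}(nth_index (true, None) uV) -(nth_map _ (F u)) ?index_mem //
    index_uniq ?size_map ?index_mem // nth_index.
pose bar x := F (vbar (code x)).
have Fnon u v w : u \in V -> v \in V -> w \in V ->
    (F w \in nonnb (F u) (F v)) = vnon u v w.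
  by move=> uV vV wV; rewrite nonnbE !FV // (inj_in_eq Fi).
have inV x : exists2 u, u \in V & x = F u by apply: Fs.
exists bar; split.
- move=> x y; have [u uV ->] := inV x; have [v vV ->] := inV y.
  by rewrite /bar codeF // !FV ?vbarV // !(inj_in_eq Fi) ?vbarV // vadj_bar.
- move=> x; have [u uV ->] := inV x; rewrite /bar !codeF ?vbarV //.
  by case: u uV => s a uV; rewrite /vbar /= negbK.
- move=> x; have [u uV ->] := inV x; have := Fc (nb (F u)).
  rewrite cardsE => ->; have /andP[/eqP <- _] := chk u uV.
  by apply: eq_in_count => v vV; rewrite inE FV.
- move=> x y; have [u uV ->] := inV x; have [v vV ->] := inV y.
  rewrite FV // => uv; have /andP[_ /allP/(_ v vV)] := chk u uV.
  rewrite uv => /= /andP[/eqP <- _]; rewrite size_filter.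
  by rewrite Fc; apply: eq_in_count => w wV; rewrite Fnon.
move=> x y z; have [u uV ->] := inV x; have [v vV ->] := inV y.
have [w wV ->] := inV z; rewrite FV // => uv wN.
have /andP[_ /allP/(_ v vV)] := chk u uV.
rewrite uv => /= /andP[_ /allP/(_ w)].
rewrite mem_filter wV andbT -Fnon // wN => /(_ isT) /eqP <-.
rewrite count_filter Fc.
by apply: eq_in_count => t tV /=; rewrite in_setI !Fnon // andbC.
Qed.

Lemma coded_taylor (G : sgraph) k : k \in [:: 1; 3; 5; 9]%N ->
  coded G (quadrangle_labels k) -> exists bar : G -> G, taylor k bar.
Proof.
move=> k4 [cG [F FV]]; have /andP[Vu Vs] := quadrangle_vlabels_ok k4.
apply: (coding_taylor Vs Vu cG FV (quadrangle_taylor_check k4)).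
exact: vlabels_bar.
Qed.

Section TaylorSharp.
Variables (R : realType) (G : sgraph) (k : nat) (bar : G -> G).
Hypotheses (T : taylor k bar) (k0 : (0 < k)%N).
Implicit Types u v w : G.
Let barE := ty_bar T.
Let barK := ty_barK T.

Lemma card_taylor_nb u : #|nb u| = (3 * k)%N.
Proof. by rewrite -(ty_reg T u); apply: eq_card => v; rewrite !inE. Qed.

Lemma taylor_nb u : exists v, adj u v.
Proof.
have /card_gt0P[v] : (0 < #|nb u|)%N by rewrite card_taylor_nb; lia.
by rewrite inE; exists v.
Qed.

(** [u] is adjacent to [bar v]; any element of [nonnb u (bar v)] is adjacent to [v] by [ty_bar]. *)
Lemma taylor_common u v : u != v -> ~~ adj u v -> v != bar u ->
  exists2 w, adj u w & adj w v.
Proof.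
move=> uv nuv vbu.
have ubv : adj u (bar v).
  by rewrite barE uv nuv andbT; apply: contra vbu => /eqP ->; rewrite barK.
have /card_gt0P[w] : (0 < #|nonnb u (bar v)|)%N by rewrite (ty_deg T ubv).
rewrite nonnbE => /and3P[uw wbv nbvw]; exists w => //.
rewrite -(barK v) barE barK wbv [adj w _]adj_sym nbvw andbT /=.
by apply: contraNneq nuv => <-.
Qed.

Lemma taylor_connected : connected_graph G.
Proof.
have near u v : v != bar u -> connect (@adj G) u v.
  move=> vbu; have [->|uv] := eqVneq u v; first exact: connect0.
  case: (boolP (adj u v)) => [|nuv]; first exact: connect1.
  by have [w uw wv] := taylor_common uv nuv vbu;
    apply: connect_trans (connect1 uw) (connect1 wv).
move=> u v; have [->|] := eqVneq v (bar u); last exact: near.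
have [w uw] := taylor_nb u; apply: connect_trans (connect1 uw) (near _ _ _).
by apply: contraTneq uw => /(inv_inj barK) ->; rewrite adj_irr.
Qed.

Let Gc := taylor_connected.

Lemma taylor_dist_le2 u v : v != bar u -> (dist u v <= 2)%N.
Proof.
move=> vbu; have [->|uv] := eqVneq u v; first by rewrite dist_xx.
case: (boolP (adj u v)) => [|nuv]; first by rewrite -(dist_eq1 Gc) => /eqP ->.
have [w uw wv] := taylor_common uv nuv vbu.
by apply: (@dist_le _ u [:: w; v]); rewrite /= uw wv.
Qed.

(** By [ty_bar] no neighbour of [u] is adjacent to [bar u], which excludes shorter paths; a
    neighbour of [u] is within distance 2 of [bar u]. *)
Lemma taylor_dist_bar u : dist u (bar u) = 3%N.
Proof.
have [w uw] := taylor_nb u.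
apply/eqP; rewrite eqn_leq; apply/andP; split.
  apply: leq_trans (dist_adjl Gc (bar u) uw) _; rewrite ltnS taylor_dist_le2 //.
  by apply: contraTneq uw => /(inv_inj barK) ->; rewrite adj_irr.
have [p [pp lp <-]] := dist_path Gc u (bar u).
case: p pp lp => [_ /= e|a [|b [|]]] //=.
- have : adj w (bar u) = false by rewrite barE [adj w u]adj_sym uw !andbF.
  by rewrite -e adj_sym uw.
- by rewrite andbT => ua e; move: ua; rewrite e barE eqxx.
- by rewrite andbT => /andP[ua ab] e; move: ab;
  rewrite e barE [adj a u]adj_sym ua !andbF.
Qed.

Lemma taylor_diam (u : G) : diam G = 3%N.
Proof.
apply/eqP; rewrite eqn_leq -{2}(taylor_dist_bar u) dist_le_diam andbT.
apply/bigmax_leqP => v _; apply/bigmax_leqP => w _.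
by have [->|/taylor_dist_le2/leqW //] := eqVneq w (bar v); rewrite taylor_dist_bar.
Qed.

(** * Optimal transport along an edge *)

Section Edge.
Variables u v : G.
Hypothesis uv : adj u v.
Local Notation N := (nonnb u v).

Let third_point w := odflt w [pick t in N :&: nonnb u w].

Let third_pointP w : w \in N -> third_point w \in N :&: nonnb u w.
Proof.
move=> wN; rewrite /third_point; case: pickP => // no.
by have := ty_third T uv wN; rewrite (eq_card0 no).
Qed.

Let third_pointK w : w \in N -> third_point (third_point w) = w.
Proof.
move=> wN; have := third_pointP wN; rewrite in_setI => /andP[tN tw].
have /eqP/cards1P[z e] := ty_third T uv tN.
have := third_pointP tN; rewrite e => /set1P ->; apply/esym/set1P.
by rewrite -e in_setI wN -nonnb_sym // ?(nonnb_sub wN) ?(nonnb_sub tN).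
Qed.

(* The optimal transport along an edge: the common part of the two balls stays,
   and [w] moves to the antipode of the third point on the line through [v], [w]. *)
Let sigma w := if w \in N then bar (third_point w) else w.

Let sigma_moved w : w \in N -> adj u (third_point w) /\ adj w (bar (third_point w)).
Proof.
move=> wN; have := third_pointP wN; move: (third_point w) => t.
rewrite in_setI !nonnbE => /and3P[_ ut /andP[tw nwt]].
split => //; rewrite barE eq_sym tw nwt andbT /=.
apply: contraTneq ut => e; move: (nonnb_sub wN); rewrite e inE barE => /and3P[_ _ h].
exact: h.
Qed.

Let sigma_target w : w \in N -> bar (third_point w) \in B1 v.
Proof.
move=> wN; have := third_pointP wN; rewrite in_setI => /andP[+ _].
rewrite nonnbE inE => /and3P[ut tv nvt].
rewrite barE [v == _]eq_sym tv nvt andbT /=.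
by case: eqVneq.
Qed.

Let sigma_source w : w \in N -> bar (third_point w) \notin B1 u.
Proof.
move=> wN; have [ut _] := sigma_moved wN; rewrite inE barE ut !andbF orbF.
by rewrite eq_sym; apply: contraTneq ut => ->; rewrite adj_sym barE eqxx.
Qed.

Let N_sub : N \subset B1 u.
Proof. by apply/subsetP => w; rewrite !inE => /andP[_ ->]; rewrite orbT. Qed.

Let sigma_inj : {in B1 u &, injective sigma}.
Proof.
move=> w w' wB w'B; rewrite /sigma; case: ifP => wN; case: ifP => w'N // e.
- by rewrite -(third_pointK wN) (inv_inj barK e) third_pointK.
- by have := sigma_source wN; rewrite e w'B.
- by have := sigma_source w'N; rewrite -e wB.
Qed.

Let sigma_im : sigma @: B1 u = B1 v.
Proof.
apply/eqP; rewrite eqEcard (card_in_imset sigma_inj) !(card_B1 _ (ty_reg T)) leqnn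
  andbT.
apply/subsetP => _ /imsetP[w wB ->]; rewrite /sigma; case: ifP => wN;
  first exact: sigma_target.
move: wB wN; rewrite nonnbE !inE => /predU1P[->|uw]; first by rewrite adj_sym uv orbT.
by rewrite uw /=; case: eqVneq => //= _ /negbFE.
Qed.

Local Notation D := (3 * k)%N.
Let plan (a b : G) : R := (a \in B1 u)%:R * (b == sigma a)%:R / D.+1%:R.

Let plan_coupling : coupling (ball_measure R D u) (ball_measure R D v) plan.
Proof.
split=> [a b|a|b]; rewrite ?(ball_measureE R Gc) -?sigma_im.
- rewrite /plan -natrM mulnb divr_ge0 ?ler0n //= ler_pdivrMr ?ltr0n // mul1r ler_nat.
  by case: (_ && _).
- rewrite -mulr_suml -mulr_sumr (bigD1 (sigma a)) //= eqxx big1 ?addr0 ?mulr1 //.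
  by move=> b /negPf ->.
rewrite -mulr_suml; congr (_ / _); case: imsetP => [[a aB ->]|no].
  rewrite (bigD1 a) //= aB eqxx mulr1 big1 ?addr0 // => c ca.
  case: (boolP (c \in B1 u)) => cB; rewrite ?mul0r // mul1r.
  by case: eqVneq => // /(sigma_inj aB cB) e; rewrite e eqxx in ca.
apply: big1 => a _; case: (boolP (a \in B1 u)) => aB; rewrite ?mul0r // mul1r.
by case: eqVneq => // e; case: no; exists a.
Qed.

(** Only the k + 1 vertices of [N] move, each along one edge. *)
Let plan_cost : cost plan = k.+1%:R / D.+1%:R.
Proof.
rewrite -(ty_deg T uv) /cost /plan.
under eq_bigr => a _.
  rewrite (bigD1 (sigma a)) //= eqxx mulr1 big1 ?addr0; last first.
    by move=> b /negPf ->; rewrite mulr0 mul0r mulr0.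
  rewrite mulrA -natrM (_ : _ * _ = (a \in N))%N; last first.
    rewrite /sigma; case: ifP => aN; last by rewrite dist_xx.
    have [_] := sigma_moved aN; rewrite -(dist_eq1 Gc) => /eqP ->.
    by rewrite (subsetP N_sub).
  over.
by rewrite /= -mulr_suml -natr_sum -sum1_card [in RHS]big_mkcond.
Qed.

Lemma taylor_W1 : W1 (ball_measure R D u) (ball_measure R D v) = k.+1%:R / D.+1%:R.
Proof.
apply/eqP; rewrite eq_le; apply/andP; split.
  by rewrite -plan_cost; apply: W1_le plan_coupling.
(* This test function certifies optimality: it picks out the k + 1 vertices of [B1 v] outside
   [B1 u]. *)
have lf : lipschitz1 (fun w => (w \in B1 v :\: B1 u)%:Z).
  by move=> a b _; do 2!case: (_ \in _).
apply: le_trans (W1_ball_ge R Gc (ty_reg T) u v lf); rewrite !sum_indicator.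
have -> : B1 u :&: (B1 v :\: B1 u) = set0.
  by apply/setP => w; rewrite !inE; case: (_ || _); rewrite ?andbF.
have -> : B1 v :&: (B1 v :\: B1 u) = nonnb v u.
  apply/setP => w; rewrite !inE; case: (eqVneq w v) => [->|_] /=;
    first by rewrite uv orbT.
  by case: (adj v w); rewrite ?andbF ?andbT.
by rewrite cards0 subr0 (ty_deg T) // adj_sym.
Qed.

Lemma taylor_curvature : curvature R D u v = 2 / 3.
Proof.
have k0' : k%:R != 0 :> R by rewrite pnatr_eq0 -lt0n.
rewrite /curvature taylor_W1 -!natr1 natrM.
have : (3 * k%:R + 1 : R) != 0 by rewrite -natrM natr1 pnatr_eq0.
by move=> h; field; rewrite k0' h.
Qed.

End Edge.

Lemma taylor_sharp (x : G) : bonnet_myers_sharp R G.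
Proof.
exists (3 * k)%N.
suff e : inf_curvature R G (3 * k) = 2 / 3.
  rewrite e (taylor_diam x); split; first exact: ty_reg T.
    by rewrite divr_gt0 ?ltr0n.
  by rewrite invf_div mulrCA divff ?mulr1 // pnatr_eq0.
(* All edges have the same curvature and [x] lies on an edge, so the set is a singleton. *)
rewrite /inf_curvature -[RHS]inf1; congr inf; apply/seteqP;
  split => [r [u [v [uv ->]]]|r ->].
  exact: taylor_curvature.
by have [v xv] := taylor_nb x; exists x, v; rewrite taylor_curvature.
Qed.

End TaylorSharp.

(** * The four graphs *)

Lemma card_ord_pred n (p : pred nat) : #|[pred i : 'I_n | p i]| = count p (iota 0 n).
Proof. by rewrite -val_enum_ord count_map cardE -size_filter enumT. Qed.

Lemma card_ord_set n (p : pred nat) : #|[set i : 'I_n | p i]| = count p (iota 0 n).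
Proof. by rewrite -card_ord_pred; apply: eq_card => i; rewrite !inE. Qed.

Definition code_matches (T : Type) (V : seq vlabel) (b : vlabel -> T)
    (a : T -> T -> bool) :=
  all (fun u => all (fun v => a (b u) (b v) == vadj u v) V) V.

Lemma code_matchesP (T : Type) (V : seq vlabel) (b : vlabel -> T) a :
  code_matches V b a -> {in V &, forall u v, a (b u) (b v) = vadj u v}.
Proof. by move=> h u v uV vV; apply/eqP; apply: (allP (allP h u uV)). Qed.

Definition count_bits (n : nat) (r : rel bool) (p q : nat -> bool) : nat :=
  count (fun i => r (p i) (q i)) (iota 0 n).

Lemma hammingE n (p q : nat -> bool) :
  hamming [ffun i : 'I_n => p i] [ffun i : 'I_n => q i] = count_bits n (fun x y =>
    x != y) p q.
Proof.
by rewrite /count_bits -card_ord_pred; apply: eq_card => i; rewrite !inE !ffunE.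
Qed.

(** The base vertex is 000, its neighbours are the unit vectors, and the antipode is the
    complement. *)
Definition cube_bits (w : vlabel) (i : nat) : bool :=
  ~~ w.1 (+) match w.2 with
  | None => false | Some (LA _) => i == 0 | Some (LB _) => i == 1 | Some _ => i == 2
  end%N.

Lemma coded_cube3 : coded cube3 (quadrangle_labels 1).
Proof.
split; first by rewrite card_ffun card_bool card_ord.
exists (fun w => [ffun i : 'I_3 => cube_bits w i] : cube3).
move=> u v uV vV; rewrite /adj /= /cube3_adj /= hammingE.
apply: (code_matchesP (b := cube_bits) (a := fun p q => count_bits 3 _ p q == 1%N))
  uV vV.
by vm_compute.
Qed.

(** The base vertex is {0, 1, 2}; [LA], [LB] and [LD] replace one element by 3, 4 and 5, where
    [LD i j] keeps i and j. The antipode is the complement. *)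
Definition johnson_bits (w : vlabel) (t : nat) : bool :=
  ~~ w.1 (+) match w.2 with
  | None => t < 3
  | Some (LA i) => ((t < 3) && (t != i)) || (t == 3)
  | Some (LB i) => ((t < 3) && (t != i)) || (t == 4)
  | Some (LD i j) => (t == i) || (t == j) || (t == 5)
  | Some LE => false
  end%N.

Lemma coded_johnson63 : coded johnson63 (quadrangle_labels 3).
Proof.
pose V := vlabels (quadrangle_labels 3).
split.
  transitivity 'C(#|'I_6|, 3); last by rewrite card_ord.
  rewrite -card_draws card_sig.
  by apply: eq_card => A; rewrite !inE.
pose S w := [set i : 'I_6 | johnson_bits w i].
have S0 : #|S (true, None)| == 3%N by rewrite card_ord_set.
pose A0 : johnson63_vertex := exist (fun A : {set 'I_6} => #|A| == 3%N) _ S0.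
pose F (w : vlabel) : johnson63_vertex := insubd A0 (S w).
have FV w : w \in V -> val (F w) = S w.
  move=> wV; apply: insubdK; rewrite unfold_in /= card_ord_set.
  have /allP h : all (fun w => count (johnson_bits w) (iota 0 6) == 3%N) V by
    vm_compute.
  exact: h.
exists (F : vlabel -> johnson63) => u v uV vV; rewrite /adj /= /johnson63_adj /= !FV //.
have -> : S u :&: S v = [set i : 'I_6 | johnson_bits u i && johnson_bits v i].
  by apply/setP => i; rewrite !inE.
rewrite (card_ord_set 6 (fun t => johnson_bits u t && johnson_bits v t)).
apply: (code_matchesP (b := johnson_bits) (a := fun p q => count_bits 6 andb p q ==
  2%N)) uV vV.
by vm_compute.
Qed.

(** The base vertex is the zero vector. Its neighbours are the 15 pairs from six coordinates,
    collinear when disjoint; this is the model of GQ(2,2) by duads. *)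
Definition demicube_bits (w : vlabel) (t : nat) : bool :=
  ~~ w.1 (+) match w.2 with
  | None => false
  | Some (LA i) => (t == i) || (t == 4)
  | Some (LB i) => (t == i) || (t == 5)
  | Some (LD i j) => [&& t < 4, t != i & t != j]
  | Some LE => 3 < t
  end%N.

(** Flipping the first coordinate exchanges even and odd vectors, so half of the 64 are even. *)
Lemma card_demicube6 : #|demicube6| = 32%N.
Proof.
rewrite card_sig; pose even (x : {ffun 'I_6 -> bool}) := ~~ odd #|[pred i | x i]|.
pose flip (x : {ffun 'I_6 -> bool}) := [ffun i => (i == ord0) (+) x i].
have flipK : involutive flip.
  by move=> x; apply/ffunP => i; rewrite !ffunE addbA addbb.
have flip_even x : even (flip x) = ~~ even x.
  rewrite /even (cardD1 ord0) [in RHS](cardD1 ord0) !inE !ffunE eqxx /= !oddD !oddb.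
  rewrite (eq_card (B := [predD1 [pred i | x i] & ord0])); last first.
    by move=> i; rewrite !inE !ffunE; case: eqVneq.
  by rewrite -addNb negb_add addbC; case: (x _); case: odd.
have := cardC even; rewrite card_ffun card_bool card_ord.
suff -> : #|[predC even]| = #|even|.
  rewrite addnn -[X in _ = X -> _]/(32.*2)%N => /double_inj <-.
  by apply: eq_card => x; rewrite !inE.
rewrite -(card_image (inv_inj flipK) even); apply: eq_card => x.
rewrite -[x \in _]/(~~ even x); apply/idP/imageP => [nx|[z]].
  by exists (flip x); rewrite ?flipK // -[_ \in _]/(even (flip x)) flip_even.
by rewrite -[z \in _]/(even z) => ez ->; rewrite flip_even ez.
Qed.

Lemma coded_demicube6 : coded demicube6 (quadrangle_labels 5).
Proof.
pose V := vlabels (quadrangle_labels 5).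
split; first by rewrite card_demicube6.
pose X w := [ffun i : 'I_6 => demicube_bits w i].
have cX w : #|[pred i | X w i]| = count (demicube_bits w) (iota 0 6).
  by rewrite -card_ord_pred; apply: eq_card => i; rewrite !inE ffunE.
have X0 : ~~ odd #|[pred i | X (true, None) i]| by rewrite cX.
pose x0 : demicube6_vertex :=
  exist (fun x : {ffun 'I_6 -> bool} => ~~ odd #|[pred i | x i]|) _ X0.
pose F (w : vlabel) : demicube6_vertex := insubd x0 (X w).
have FV w : w \in V -> val (F w) = X w.
  move=> wV; apply: insubdK; rewrite unfold_in /= cX.
  have /allP h : all (fun w => ~~ odd (count (demicube_bits w) (iota 0 6))) V by
    vm_compute.
  exact: h.
exists (F : vlabel -> demicube6) => u v uV vV;
  rewrite /adj /= /demicube6_adj /= !FV // hammingE.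
apply: (code_matchesP (b := demicube_bits) (a := fun p q => count_bits 6 _ p q ==
  2%N)) uV vV.
by vm_compute.
Qed.

(** * The Gosset graph as signed pairs of coordinates *)

Section GossetCoding.
Variable R : realType.
Local Notation pair8 := {E : {set 'I_8} | #|E| == 2%N}.

Definition signed_pair (s : bool) (E : {set 'I_8}) : 'rV[R]_8 :=
  \row_i ((if s then 1 else -1) * (if i \in E then 3 else -1)).

Lemma signed_pair_mem s (E : {set 'I_8}) : #|E| == 2%N -> signed_pair s E \in
  gosset_vectors R.
Proof.
case/cards2P => i1 [i2 [i12 ->]].
pose p := tperm i1 (inord 0); pose q := tperm (p i2) (inord 1).
have ne01 : inord 0 != inord 1 :> 'I_8 by rewrite -val_eqE /= !inordK.
have p2 : p i2 != inord 0 by rewrite -(tpermL i1 (inord 0)) (inj_eq perm_inj) eq_sym.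
have e1 : (p * q)%g i1 = inord 0.
  by rewrite permM tpermL tpermD // eq_sym.
have e2 : (p * q)%g i2 = inord 1 by rewrite permM tpermL.
apply/allpairsP; exists (if s then gosset_base R else - gosset_base R, (p * q)%g).
split=> /=; [by case: s; rewrite !inE eqxx ?orbT | by rewrite mem_enum |].
apply/rowP => j; rewrite !mxE.
have -> : (j \in [set i1; i2]) = ((p * q)%g j < 2)%N.
  have pqi := inj_eq (@perm_inj _ (p * q)%g).
  rewrite !inE -(pqi j i1) -(pqi j i2) e1 e2 -!val_eqE /= !inordK //.
  by case: (val _) => [|[|]].
by case: s; rewrite !mxE; case: ifP; rewrite ?mulN1r ?mul1r.
Qed.

Lemma gosset_signed_pair (u : gosset R) :
  exists s (E : {set 'I_8}), #|E| == 2%N /\ val u = signed_pair s E.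
Proof.
have /allpairsP[[v t] /= [+ _ ->]] := valP u.
pose E := [set j | (t j < 2)%N].
have cE : #|E| == 2%N.
  have -> : E = t @^-1: [set i : 'I_8 | (i < 2)%N] by apply/setP => j; rewrite !inE.
  rewrite card_preimset; last exact: perm_inj.
  by rewrite (card_ord_set 8 (fun i => i < 2)%N).
rewrite !inE => /orP[] /eqP ->; [exists true, E|exists false, E]; split => //;
  by apply/rowP => j; rewrite !mxE inE; case: ifP; rewrite ?mulN1r ?mul1r.
Qed.

(** Up to the product of the signs the inner product is 16n - 8, where n is the number of common
    positions: n = 1 gives 8 and n = 0 gives -8. *)
Lemma inner_signed_pair s t (E F : {set 'I_8}) : #|E| == 2%N -> #|F| == 2%N ->
  (inner (signed_pair s E) (signed_pair t F) == 8)
    = (#|E :&: F| == if s == t then 1%N else 0%N).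
Proof.
move=> /eqP cE /eqP cF; rewrite /inner.
set e : R := (if s then 1 else -1) * (if t then 1 else -1).
rewrite (eq_bigr (fun i => e * (16 * (i \in E :&: F)%:R - 4 * (i \in E)%:R
  - 4 * (i \in F)%:R + 1))); last first.
  move=> i _; rewrite !mxE in_setI /e.
  by case: (i \in E); case: (i \in F); rewrite /= ?mulr1 ?mulr0; ring.
have cs (S : {set 'I_8}) : \sum_i (i \in S)%:R = #|S|%:R :> R.
  by rewrite -natr_sum -sum1_card [in RHS]big_mkcond.
rewrite -mulr_sumr !big_split /= !sumrN -!mulr_sumr !cs cE cF sumr_const card_ord.
set n := #|_|; rewrite [X in X == _](_ : _ = e * (16 * n%:R - 8)); last by ring.
have -> : e = if s == t then 1 else -1.
  by rewrite /e; clear e; case: s; case: t; rewrite /= ?mulr1 ?mul1r ?mulrNN ?mulr1.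
case: (s == t); rewrite ?mul1r ?mulN1r.
  rewrite subr_eq -natrD -natrM eqr_nat; lia.
rewrite opprB subr_eq addrC -subr_eq subrr eq_sym -natrM pnatr_eq0; lia.
Qed.

(** The base vertex is the positive pair {6, 7}. Its 27 neighbours are the 12 positive pairs meeting
    it in one position and the 15 negative pairs disjoint from it. *)
Definition gosset_pair (w : vlabel) : bool * (nat * nat) :=
  match w.2 with
  | None => (w.1, (6, 7))
  | Some (LA i) => (w.1, (i, 6))
  | Some (LB i) => (w.1, (i, 7))
  | Some (LD i j) => (~~ w.1, (i, j))
  | Some LE => (w.1, (0, 0))
  end%N.

Definition pair_bits (u : nat * nat) (t : nat) : bool := (t == u.1) || (t == u.2).

Lemma coded_gosset : coded (gosset R) (quadrangle_labels 9).
Proof.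
pose V := vlabels (quadrangle_labels 9).
pose S w := [set i : 'I_8 | pair_bits (gosset_pair w).2 i].
pose X w := signed_pair (gosset_pair w).1 (S w).
have cS w : w \in V -> #|S w| == 2%N.
  move=> wV; rewrite card_ord_set.
  have /allP h : all (fun w => count (pair_bits (gosset_pair w).2) (iota 0 8) == 2%N) V
    by vm_compute.
  exact: h.
have XP w : w \in V -> X w \in gosset_vectors R.
  by move=> wV; apply: signed_pair_mem; apply: cS.
have V0 : (true, None) \in V by [].
pose F (w : vlabel) : seq_sub (gosset_vectors R) := insubd (SeqSub (XP _ V0)) (X w).
have FV w : w \in V -> val (F w) = X w by move=> wV; rewrite insubdK ?XP.
have Fadj : {in V &, forall u v, gosset_adj (F u) (F v) = vadj u v}.
  move=> u v uV vV; rewrite /gosset_adj /= !FV // inner_signed_pair ?cS //.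
  have -> : S u :&: S v = [set i : 'I_8 | pair_bits (gosset_pair u).2 i &&
    pair_bits (gosset_pair v).2 i].
    by apply/setP => i; rewrite !inE.
  rewrite (card_ord_set 8 (fun t => pair_bits (gosset_pair u).2 t && pair_bits
    (gosset_pair v).2 t)).
  apply: (code_matchesP (b := gosset_pair) (a := fun p q =>
    count_bits 8 andb (pair_bits p.2) (pair_bits q.2) == if p.1 == q.1 then 1%N
      else 0%N)) uV vV.
  by vm_compute.
split; last by exists (F : vlabel -> gosset R).
have /andP[Vu Vs] := @quadrangle_vlabels_ok 9 isT.
(* Injectivity of the coding gives at least 56 vertices; the 2 * 28 signed pairs cover all vertices,
   so there are at most 56. *)
apply/eqP; rewrite eqn_leq; apply/andP; split; last first.
  have Fi : {in V &, injective F} := separated_inj Vs Fadj.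
  have uF : uniq (map F V) by rewrite map_inj_in_uniq.
  by rewrite -(size_map F) -(card_uniqP uF) max_card.
pose P (u : bool * pair8) : gosset R := insubd (SeqSub (XP _ V0)) (signed_pair u.1
  (val u.2)).
have -> : size (vlabels (quadrangle_labels 9)) = #|{: bool * pair8}|.
  transitivity (2 * 'C(#|'I_8|, 2))%N; first by rewrite card_ord.
  rewrite card_prod card_bool card_sig -card_draws; congr (_ * _)%N.
  by apply: eq_card => A; rewrite !inE.
rewrite -cardsT; apply: leq_trans (leq_imset_card P _); apply: subset_leq_card.
apply/subsetP => u _; have [s [E [cE e]]] := gosset_signed_pair u.
apply/imsetP; exists (s, Sub E cE) => //; apply: val_inj.
by rewrite /P /= insubdK -?e //; apply: (valP u).
Qed.

End GossetCoding.

Local Close Scope ring_scope.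

Theorem theorem1p2 (R : realType) (G : sgraph) :
  (connected_graph G -> bonnet_myers_sharp R G -> diam G = 3 ->
     self_centered G)
  /\
  ([/\ connected_graph G, bonnet_myers_sharp R G & diam G = 3] <->
   [\/ isomorphic G cube3, isomorphic G johnson63,
       isomorphic G demicube6 | isomorphic G (gosset R)]).
Proof.
have fwd : connected_graph G -> bonnet_myers_sharp R G -> diam G = 3%N ->
    exists2 k, k \in [:: 1; 3; 5; 9]%N & coded G (quadrangle_labels k).
  move=> Gc Gs d3; have [D [D0 Greg GT]] := sharp_transport_bound Gc Gs d3.
  (* An empty graph would have diameter 0, the value of an empty maximum. *)
  have G0 : (0 < #|G|)%N.
    rewrite lt0n; apply/eqP => G0; move: d3; rewrite /diam big1 // => x _.
    by have := max_card (pred1 x); rewrite card1 G0.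
  have [x [y]] := diam_attained G0; rewrite d3 => xy3.
  have [k [k0 L]] := transport_levels Gc D0 Greg GT xy3.
  by have [k4 cG] := levels_coded L k0; exists k.
have bwd k : k \in [:: 1; 3; 5; 9]%N -> coded G (quadrangle_labels k) ->
    [/\ connected_graph G, bonnet_myers_sharp R G, diam G = 3%N & self_centered G].
  move=> k4 cG; have [bar T] := coded_taylor k4 cG.
  have k0 : (0 < k)%N by case: k k4 {cG T}.
  have [_ [F _]] := cG; have x := F (true, None).
  split; [exact: taylor_connected T k0 | exact: taylor_sharp T k0 x
    | exact: taylor_diam T k0 x | move=> u; exists (bar u)].
  by rewrite (taylor_dist_bar T k0) (taylor_diam T k0 u).
have ok k (h : k \in [:: 1; 3; 5; 9]%N) := andP (quadrangle_vlabels_ok h).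
split.
  (* Self-centredness is read off from the coding: there each vertex has an antipode at distance
     3. *)
  by move=> Gc Gs d3; have [k k4 cG] := fwd Gc Gs d3; have [] := bwd k k4 cG.
split.
  case=> Gc Gs d3; have [k k4 cG] := fwd Gc Gs d3.
  have [Vu Vs] := ok k k4; have iso H := coded_isomorphic Vs Vu cG (H := H).
  move: k4; rewrite !inE => /or4P[] /eqP ek; subst k.
  - by apply: Or41; apply: iso coded_cube3.
  - by apply: Or42; apply: iso coded_johnson63.
  - by apply: Or43; apply: iso coded_demicube6.
  - by apply: Or44; apply: iso (coded_gosset R).
case=> /isomorphic_coded h.
- by have [] := bwd 1%N isT (h _ coded_cube3).
- by have [] := bwd 3%N isT (h _ coded_johnson63).
- by have [] := bwd 5%N isT (h _ coded_demicube6).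
- by have [] := bwd 9%N isT (h _ (coded_gosset R)).
Qed.
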